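(* Let the functions $f$ and $g^r$, $r=1,\ldots,m$, be admissible (as defined in the context) with constants $L\in(0,\infty)$, $\eta\in(1,\infty)$ and some $q\in(1,\infty)$. Further, let $\overline{h}\in(0,L^{-1})$ with $\overline{h}\le T$. Then, for every $\xi\in L^2(\Omega,\mathcal{F}_0,\mathbf{P};\mathbb{R}^d)$ the split-step backward Euler scheme $(\Psi^{\mathrm{SSBE}},\overline{h},\xi)$ is stochastically C-stable.
   Context: Let $d,m\in\mathbb{N}$, $T\in(0,\infty)$, and let $(\Omega,\mathcal{F},(\mathcal{F}_t)_{t\in[0,T]},\mathbf{P})$ be a filtered probability space satisfying the usual conditions, with independent real-valued standard $(\mathcal{F}_t)$-Brownian motions $W^1,\ldots,W^m$. $|\cdot|$ and $\langle\cdot,\cdot\rangle$ are the Euclidean norm and inner product; $\|Y\|_{L^p(\Omega;\mathbb{R}^d)}=(\mathbb{E}|Y|^p)^{1/p}$. Admissible: $f,g^r\colon[0,T]\times\mathbb{R}^d\to\mathbb{R}^d$, $r=1,\ldots,m$, are admissible with constants $L>0$, $\eta\in(\frac12,\infty)$, $q\in(1,\infty)$ if they are continuous and for all $t,t_1,t_2\in[0,T]$, $x,x_1,x_2\in\mathbb{R}^d$ and $r=1,\ldots,m$: $\langle f(t,x_1)-f(t,x_2),x_1-x_2\rangle+\eta\sum_{r=1}^m|g^r(t,x_1)-g^r(t,x_2)|^2\le L|x_1-x_2|^2$; $|f(t,x)|\vee|g^r(t,x)|\le L(1+|x|^q)$; $|f(t_1,x)-f(t_2,x)|\vee|g^r(t_1,x)-g^r(t_2,x)|\le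 L(1+|x|^q)|t_1-t_2|^{1/2}$; $|f(t,x_1)-f(t,x_2)|\vee|g^r(t,x_1)-g^r(t,x_2)|\le L(1+|x_1|^{q-1}+|x_2|^{q-1})|x_1-x_2|$. Let $\mathbb{T}:=\{(t,\delta)\in[0,T)\times(0,\overline{h}]:t+\delta\le T\}$. SSBE one-step map: for $\delta\in(0,\overline{h}]$ with $\overline{h}<L^{-1}$ put $F_\delta(t,x)=x-\delta f(t,x)$; then $F_\delta(t,\cdot)\colon\mathbb{R}^d\to\mathbb{R}^d$ is a homeomorphism with inverse $F_\delta^{-1}(t,\cdot)$. For $x\in\mathbb{R}^d$, $(t,\delta)\in\mathbb{T}$ define $\Psi^{\mathrm{SSBE}}(x,t,\delta)=F_\delta^{-1}(t+\delta,x)+\sum_{r=1}^m g^r(t+\delta,F_\delta^{-1}(t+\delta,x))(W^r(t+\delta)-W^r(t))$. A stochastic one-step method $(\Psi,\overline{h},\xi)$ is called stochastically C-stable if there exist a constant $C_{\mathrm{stab}}$ and a parameter value $\eta'\in(1,\infty)$ such that for all $(t,\delta)\in\mathbb{T}$ and all $Y,Z\in L^2(\Omega,\mathcal{F}_t,\mathbf{P};\mathbb{R}^d)$: $$\|\mathbb{E}[\Psi(Y,t,\delta)-\Psi(Z,t,\delta)|\mathcal{F}_t]\|_{L^2(\Omega;\mathbb{R}^d)}^2+\eta'\|(\mathrm{id}-\mathbb{E}[\,\cdot\,|\mathcal{F}_t])(\Psi(Y,t,\delta)-\Psi(Z,t,\delta))\|_{L^2(\Omega;\mathbb{R}^d)}^2\le(1+C_{\mathrm{stab}}\delta)\|Y-Z\|_{L^2(\Omega;\mathbb{R}^d)}^2,$$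 where $(\mathrm{id}-\mathbb{E}[\,\cdot\,|\mathcal{F}_t])V:=V-\mathbb{E}[V|\mathcal{F}_t]$ and $\Psi(Z,t,\delta)$ is the random variable $\omega\mapsto\Psi(Z(\omega),t,\delta,\omega)$. (Being a stochastic one-step method means: $\xi\in L^2(\Omega,\mathcal{F}_0,\mathbf{P};\mathbb{R}^d)$ and $\Psi(Z,t,\delta)\in L^2(\Omega,\mathcal{F}_{t+\delta},\mathbf{P};\mathbb{R}^d)$ for all $(t,\delta)\in\mathbb{T}$, $Z\in L^2(\Omega,\mathcal{F}_t,\mathbf{P};\mathbb{R}^d)$.) *)

(* Defs.v *)
From HB Require Import structures.
From mathcomp Require Import all_boot all_order all_algebra.
From mathcomp Require Import all_classical all_reals all_analysis.

Set Implicit Arguments.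
Unset Strict Implicit.
Unset Printing Implicit Defensive.

Import Order.TTheory GRing.Theory Num.Theory.
Import numFieldNormedType.Exports.

Local Open Scope classical_set_scope.
Local Open Scope ring_scope.

(* Families indexed by the time interval [0, T] are represented by functions
   of t : R; only their values at times t with 0 <= t <= T are ever used. *)

Section Euclidean.
Context {R : realType} {d : nat}.

Definition dotp (x y : 'rV[R]_d) : R := \sum_(i < d) x 0 i * y 0 i.

(* The library norm `|x| on 'rV[R]_d is the maximum norm. *)
Definition enorm (x : 'rV[R]_d) : R := Num.sqrt (dotp x x).

End Euclidean.

Section RandomVariables.
Context {R : realType} {dO : measure_display} {Omega : measurableType dO}.
Variable P : probability Omega R.
Implicit Types G : set_system Omega.

Definition borel (E : topologicalType) : set_system E := <<s [set U : set E | open U] >>.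

Definition measurable_wrt (E : topologicalType) G (X : Omega -> E) : Prop :=
  forall B : set E, borel B -> G (X @^-1` B).

Definition L2norm (d : nat) (Y : Omega -> 'rV[R]_d) : \bar R :=
  ('N[P]_2%:E[EFin \o (fun w => enorm (Y w))])%E.

Definition inL2 (d : nat) G (Y : Omega -> 'rV[R]_d) : Prop :=
  measurable_wrt G Y /\ (L2norm Y < +oo)%E.

Record is_condexp G (X V : Omega -> R) : Prop := {
  condexp_measurable : measurable_wrt G V ;
  condexp_integrable : P.-integrable setT (EFin \o V) ;
  condexp_integral : forall A, G A ->
    (\int[P]_(w in A) (V w)%:E = \int[P]_(w in A) (X w)%:E)%E }.

(* Some version of E[X | G]; any two versions agree P-almost surely. *)
Definition condexp G (X : Omega -> R) : Omega -> R :=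
  xget (fun=> 0) [set V | is_condexp G X V].

Definition condexpv (d : nat) G (X : Omega -> 'rV[R]_d) : Omega -> 'rV[R]_d :=
  fun w => \row_i condexp G (fun w' => X w' 0 i) w.

End RandomVariables.

Section Filtrations.
Context {R : realType} {dO : measure_display} {Omega : measurableType dO}.
Variables (P : probability Omega R) (T : R).

(* As F 0 consists of measurable sets, usual_complete also says that P itself
   is complete. *)
Record usual_filtration (F : R -> set_system Omega) : Prop := {
  filtration_sigma : forall t : R, 0 <= t <= T -> sigma_algebra setT (F t) ;
  filtration_sub : forall t : R, 0 <= t <= T -> F t `<=` measurable ;
  filtration_mono : forall s t : R, 0 <= s -> s <= t -> t <= T -> F s `<=` F t ;
  usual_right_continuous : forall t : R, 0 <= t < T ->
    \bigcap_(s in [set s : R | t < s <= T]) F s = F t ;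
  usual_complete : P.-negligible `<=` F 0 }.

Definition increment (W : R -> Omega -> R) (s t : R) : Omega -> R :=
  fun w => W t w - W s w.

Record standard_brownian_motion (F : R -> set_system Omega)
    (W : R -> Omega -> R) : Prop := {
  bm_adapted : forall t : R, 0 <= t <= T -> measurable_wrt (F t) (W t) ;
  bm_start : {ae P, forall w, W 0 w = 0} ;
  bm_continuous : {ae P, forall w, {within [set t : R | 0 <= t <= T],
                                    continuous (fun t => W t w)}} ;
  bm_normal : forall s t : R, 0 <= s -> s < t -> t <= T ->
    forall B : set R, measurable B ->
      P (increment W s t @^-1` B) = normal_prob 0 (Num.sqrt (t - s)) B ;
  bm_indep : forall s t : R, 0 <= s -> s < t -> t <= T ->
    forall (A : set Omega) (B : set R), F s A -> measurable B ->
      P (A `&` increment W s t @^-1` B)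
      = (P A * P (increment W s t @^-1` B))%E }.

Definition process_sigma (W : R -> Omega -> R) : set_system Omega :=
  <<s [set A | exists2 t : R, 0 <= t <= T &
               exists2 B : set R, measurable B & A = W t @^-1` B] >>.

(* Independence of finitely many sigma-algebras: since each contains setT, the
   product rule for the full family covers all subfamilies. *)
Definition independent_processes (m : nat) (W : 'I_m -> R -> Omega -> R) : Prop :=
  forall A : 'I_m -> set Omega, (forall r, process_sigma (W r) (A r)) ->
    P (\bigcap_(r in [set: 'I_m]) A r) = (\big[mule/1]_(r < m) P (A r))%E.

End Filtrations.

Record admissible {R : realType} {d m : nat} (T L eta q : R)
    (f : R -> 'rV[R]_d -> 'rV[R]_d)
    (g : 'I_m -> R -> 'rV[R]_d -> 'rV[R]_d) : Prop := {
  adm_L : 0 < L ;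
  adm_eta : 2^-1 < eta ;
  adm_q : 1 < q ;
  adm_continuous_f : {within [set p : R * 'rV[R]_d | 0 <= p.1 <= T],
    continuous (fun p => f p.1 p.2)} ;
  adm_continuous_g : forall r, {within [set p : R * 'rV[R]_d | 0 <= p.1 <= T],
    continuous (fun p => g r p.1 p.2)} ;
  adm_monotone : forall (t : R) x1 x2, 0 <= t <= T ->
    dotp (f t x1 - f t x2) (x1 - x2)
      + eta * \sum_(r < m) enorm (g r t x1 - g r t x2) ^+ 2
    <= L * enorm (x1 - x2) ^+ 2 ;
  adm_growth : forall (t : R) x r, 0 <= t <= T ->
    Num.max (enorm (f t x)) (enorm (g r t x)) <= L * (1 + enorm x `^ q) ;
  adm_holder : forall (t1 t2 : R) x r, 0 <= t1 <= T -> 0 <= t2 <= T ->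
    Num.max (enorm (f t1 x - f t2 x)) (enorm (g r t1 x - g r t2 x))
    <= L * (1 + enorm x `^ q) * `|t1 - t2| `^ 2^-1 ;
  adm_lipschitz : forall (t : R) x1 x2 r, 0 <= t <= T ->
    Num.max (enorm (f t x1 - f t x2)) (enorm (g r t x1 - g r t x2))
    <= L * (1 + enorm x1 `^ (q - 1) + enorm x2 `^ (q - 1)) * enorm (x1 - x2) }.

Section OneStepMethods.
Context {R : realType} {dO : measure_display} {Omega : measurableType dO}
  {d : nat}.
Variables (P : probability Omega R) (T : R) (F : R -> set_system Omega).

Definition time_steps (hbar : R) : set (R * R) :=
  [set p | [/\ 0 <= p.1 < T, 0 < p.2 <= hbar & p.1 + p.2 <= T]].

Definition apply_step (Psi : 'rV[R]_d -> R -> R -> Omega -> 'rV[R]_d)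
    (Z : Omega -> 'rV[R]_d) (t delta : R) : Omega -> 'rV[R]_d :=
  fun w => Psi (Z w) t delta w.

Record one_step_method (Psi : 'rV[R]_d -> R -> R -> Omega -> 'rV[R]_d)
    (hbar : R) (xi : Omega -> 'rV[R]_d) : Prop := {
  osm_initial : inL2 P (F 0) xi ;
  osm_step : forall t delta, time_steps hbar (t, delta) ->
    forall Z, inL2 P (F t) Z ->
      inL2 P (F (t + delta)) (apply_step Psi Z t delta) }.

Definition stochastically_C_stable
    (Psi : 'rV[R]_d -> R -> R -> Omega -> 'rV[R]_d)
    (hbar : R) (xi : Omega -> 'rV[R]_d) : Prop :=
  one_step_method Psi hbar xi /\
  exists Cstab eta' : R, 1 < eta' /\
    forall t delta, time_steps hbar (t, delta) ->
    forall Y Z, inL2 P (F t) Y -> inL2 P (F t) Z ->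
      let D := fun w => apply_step Psi Y t delta w - apply_step Psi Z t delta w in
      let ED := condexpv P (F t) D in
      (L2norm P ED ^+ 2 + eta'%:E * L2norm P (fun w => D w - ED w)%R ^+ 2
       <= (1 + Cstab * delta)%:E * L2norm P (fun w => Y w - Z w)%R ^+ 2)%E.

End OneStepMethods.

Section SSBE.
Context {R : realType} {dO : measure_display} {Omega : measurableType dO}
  {d m : nat}.
Variables (f : R -> 'rV[R]_d -> 'rV[R]_d)
  (g : 'I_m -> R -> 'rV[R]_d -> 'rV[R]_d) (W : 'I_m -> R -> Omega -> R).

Definition implicit_map (delta t : R) (x : 'rV[R]_d) : 'rV[R]_d :=
  x - delta *: f t x.

(* For admissible f and 0 < delta < L^-1 the map implicit_map delta t is a
   homeomorphism of 'rV[R]_d, so the y below exists and is unique. *)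
Definition implicit_inv (delta t : R) (x : 'rV[R]_d) : 'rV[R]_d :=
  xget 0 [set y | implicit_map delta t y = x].

Definition ssbe_step (x : 'rV[R]_d) (t delta : R) (w : Omega) : 'rV[R]_d :=
  let y := implicit_inv delta (t + delta) x in
  y + \sum_(r < m) increment (W r) t (t + delta) w *: g r (t + delta) y.

End SSBE.

(* Main.v *)
Require Import Defs.
From HB Require Import structures.
From mathcomp Require Import all_boot all_order all_algebra.
From mathcomp Require Import all_classical all_reals all_analysis.
From mathcomp Require Import measurable_realfun ring lra.

Set Implicit Arguments.
Unset Strict Implicit.
Unset Printing Implicit Defensive.

Import Order.TTheory GRing.Theory Num.Theory.
Import numFieldNormedType.Exports.

Local Open Scope classical_set_scope.
Local Open Scope ring_scope.

(** Fix a step [(t, delta)], states [Y], [Z] known at time [t], and write [y], [z] for the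
    images of [Y], [Z] under the implicit inverse.  The difference of the two steps is
    [y - z] plus a sum of Brownian increments with coefficients [g r y - g r z] that are
    known at time [t].  The first part is its conditional expectation, and by the Ito
    isometry the second has mean square [delta * E sum_r |g r y - g r z|^2].  So it suffices
    to prove, pathwise,

      [|y - z|^2 + 2 eta delta sum_r |g r y - g r z|^2 <= (1 + C delta) |Y - Z|^2],

    and to take [eta' = 2 eta > 1].  Since [Y - Z = (y - z) - delta (f y - f z)], the coupled
    monotonicity condition gives
    [(1 - delta L) |y - z|^2 + eta delta sum_r |g r y - g r z|^2 <= <Y - Z, y - z>], and
    Young's inequality yields the bound with [C = 2 L / (1 - hbar L)^2]
    ([ssbe_pathwise_stability]).

    Three points need work.  First, the implicit equation has a solution: a strongly
    monotone, locally Lipschitz map of a Euclidean space is onto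
    ([strongly_monotone_surjective]).  The same monotonicity estimate shows that the implicit
    inverse, and even [g r] composed with it, are globally Lipschitz, so that all variables
    involved are measurable and square integrable.

    Secondly, the isometry needs the first two moments of the normal law and the product
    rule for independent variables ([normal_prob_mean], [normal_prob_mean_sqr],
    [indep_Rintegral_mul]).

    Thirdly, its cross terms must vanish.  The hypotheses make each motion independent of
    the past and the motions independent of each other, but do not say that the vector of
    increments is independent of the past.  It is the vanishing of the bracket of two
    independent Brownian motions that makes their increments conditionally uncorrelated
    ([cross_mean]). *)

(** * Euclidean geometry of row vectors *)

Section Euclid.
Context {R : realType}.

Section Dot.
Context {d : nat}.
Implicit Types x y z : 'rV[R]_d.

Lemma dotpC x y : dotp x y = dotp y x.
Proof. by apply: eq_bigr => i _; rewrite mulrC. Qed.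

Lemma dotpDl x y z : dotp (x + y) z = dotp x z + dotp y z.
Proof. by rewrite /dotp -big_split; apply: eq_bigr => i _; rewrite mxE mulrDl. Qed.

Lemma dotpZl (k : R) x z : dotp (k *: x) z = k * dotp x z.
Proof. by rewrite /dotp mulr_sumr; apply: eq_bigr => i _; rewrite mxE mulrA. Qed.

Lemma dotpDr x y z : dotp z (x + y) = dotp z x + dotp z y.
Proof. by rewrite dotpC dotpDl !(dotpC z). Qed.

Lemma dotpZr (k : R) x z : dotp z (k *: x) = k * dotp z x.
Proof. by rewrite dotpC dotpZl dotpC. Qed.

Lemma dotpNl x z : dotp (- x) z = - dotp x z.
Proof. by rewrite -scaleN1r dotpZl mulN1r. Qed.

Lemma dotpNr x z : dotp z (- x) = - dotp z x.
Proof. by rewrite dotpC dotpNl dotpC. Qed.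

Definition dotpE := (dotpDl, dotpDr, dotpNl, dotpNr, dotpZl, dotpZr).

Lemma dotp_ge0 x : 0 <= dotp x x.
Proof. by apply: sumr_ge0 => i _; rewrite -expr2 sqr_ge0. Qed.

Lemma enorm_sqr x : enorm x ^+ 2 = dotp x x.
Proof. by rewrite sqr_sqrtr// dotp_ge0. Qed.

Lemma enorm_ge0 x : 0 <= enorm x.
Proof. exact: sqrtr_ge0. Qed.

Lemma sqr_coord_le_dotp x i : x 0 i ^+ 2 <= dotp x x.
Proof.
rewrite /dotp (bigD1 i)//= -expr2 lerDl.
by apply: sumr_ge0 => j _; rewrite -expr2 sqr_ge0.
Qed.

Lemma dotp_eq0 x : dotp x x = 0 -> x = 0.
Proof.
move=> x0; apply/rowP => i; rewrite mxE; apply/eqP.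
by rewrite -sqrf_eq0 eq_le sqr_ge0 andbT -x0 sqr_coord_le_dotp.
Qed.

(** Expand [0 <= |c x - y|^2]. *)
Lemma dotp_young (c : R) x y : 0 < c ->
  2 * dotp x y <= c * dotp x x + dotp y y / c.
Proof.
move=> c0; have := dotp_ge0 (c *: x - y); rewrite !dotpE (dotpC y x) => H.
rewrite -(ler_pM2l c0) mulrDr (mulrC (dotp y y)) mulVKf ?gt_eqF//; lra.
Qed.

(** Parallelogram identity, with one of the two diagonals dropped. *)
Lemma dotp_double x z : dotp x x <= 2 * dotp (x - z) (x - z) + 2 * dotp z z.
Proof.
have -> : dotp x x = dotp ((x - z) + z) ((x - z) + z) by rewrite subrK.
move: (x - z) => p; have := dotp_ge0 (p - z).
by rewrite !dotpE (dotpC z p); lra.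
Qed.

End Dot.

(** The topology on row vectors is that of the maximum norm, whereas the bound is
    Euclidean: the factor [d%:R] in the choice of the radius pays for the comparison. *)
Lemma locally_lipschitz_continuous d d' (h : 'rV[R]_d -> 'rV[R]_d') :
  (forall x, exists K, forall y, dotp (y - x) (y - x) <= 1 ->
     dotp (h y - h x) (h y - h x) <= K * dotp (y - x) (y - x)) -> continuous h.
Proof.
move=> H x; have [K HK] := H x.
apply: (@cvg_ballP _ _ _ (nbhs x) _ h (h x)).2 => e e0.
pose C := 1 + `|K| + d%:R : R.
have K0 : 0 <= `|K| by [].
have d0 : 0 <= d%:R :> R by [].
have [C1 dC KC] : [/\ 1 <= C, d%:R <= C & `|K| <= C] by rewrite /C; split; lra.
pose u := Num.min 1 e / 2 : R.
have u0 : 0 < u by rewrite divr_gt0// lt_min ltr01.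
have u1 : u <= 1 by rewrite /u ler_pdivrMr// ge_min; apply/orP; left; lra.
have ue : u < e.
  rewrite /u ltr_pdivrMr//; apply: (@le_lt_trans _ _ e); last lra.
  by rewrite ge_min lexx orbT.
have C0 : 0 < C by lra.
pose r := u / C.
have r0 : 0 < r by rewrite divr_gt0.
have rC : C * r = u by rewrite /r mulrC divfK ?gt_eqF.
clearbody r.
apply/nbhs_ballP; exists r => //= y xy.
have dxy : dotp (y - x) (y - x) <= d%:R * r ^+ 2.
  rewrite /dotp mulr_natl -[X in _ *+ X]card_ord -sumr_const.
  apply: ler_sum => i _; rewrite -expr2 !mxE.
  rewrite -(ger0_norm (sqr_ge0 _)) normrX lerXn2r ?nnegrE ?(ltW r0)// distrC ltW//.
  by case: xy => _ /(_ 0 i).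
have u2 : d%:R * r ^+ 2 <= u ^+ 2.
  rewrite -rC exprMn ler_wpM2r ?sqr_ge0// (le_trans dC)//.
  by rewrite expr2 ler_peMr// ltW.
have hxy : dotp (h y - h x) (h y - h x) <= `|K| * (d%:R * r ^+ 2).
  apply: le_trans (HK y _) _.
    by rewrite (le_trans dxy)// (le_trans u2)// expr_le1// ltW.
  apply: (@le_trans _ _ (`|K| * dotp (y - x) (y - x))).
    by rewrite ler_wpM2r ?dotp_ge0// ler_norm.
  by rewrite ler_wpM2l.
split => // i j; rewrite ord1 /ball/=.
have := sqr_coord_le_dotp (h y - h x) j; rewrite !mxE => /le_trans /(_ hxy).
have e2 : `|K| * (d%:R * r ^+ 2) < e ^+ 2.
  apply: (@le_lt_trans _ _ (u ^+ 2)).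
    rewrite -rC exprMn (expr2 C) -mulrA; apply: ler_pM => //.
      by rewrite mulr_ge0// sqr_ge0.
    by rewrite ler_wpM2r// sqr_ge0.
  by rewrite ltrXn2r ?nnegrE// ltW.
move=> /le_lt_trans /(_ e2).
rewrite -(ger0_norm (sqr_ge0 (h y 0 j - _))) normrX distrC.
by rewrite ltr_pXn2r// nnegrE// ltW.
Qed.

Lemma continuous_dotp d d' (f g : 'rV[R]_d -> 'rV[R]_d') :
  continuous f -> continuous g -> continuous (fun x => dotp (f x) (g x)).
Proof.
move=> cf cg; apply: continuous_big; first exact: add_continuous.
move=> i _ x; apply: continuousM.
- apply: (@continuous_comp _ _ _ f (fun v : 'rV[R]_d' => v 0 i)); first exact: cf.
  exact: coord_continuous.
- apply: (@continuous_comp _ _ _ g (fun v : 'rV[R]_d' => v 0 i)); first exact: cg.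
  exact: coord_continuous.
Qed.

(** The squared residual [phi x = |h x - b|^2] is coercive by strong monotonicity, so
    its minimum over a large cube is global.  Where the residual [v] is nonzero, a step
    [- tau v] changes [h] by some [w] with [<v, w> <= - c tau |v|^2] and
    [|w|^2 <= K tau^2 |v|^2], so a small [tau] decreases the residual. *)
Lemma strongly_monotone_surjective d (h : 'rV[R]_d -> 'rV[R]_d) (c : R) : 0 < c ->
  (forall x y, c * dotp (x - y) (x - y) <= dotp (h x - h y) (x - y)) ->
  (forall x, exists K, forall y, dotp (y - x) (y - x) <= 1 ->
     dotp (h y - h x) (h y - h x) <= K * dotp (y - x) (y - x)) ->
  forall b, exists x, h x = b.
Proof.
move=> c0 mono loc b.
pose phi x := dotp (h x - b) (h x - b).
have cphi : continuous phi.
  have chb : continuous (fun x => h x - b).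
    apply: locally_lipschitz_continuous => x; have [K HK] := loc x.
    by exists K => y; rewrite opprB addrA subrK; exact: HK.
  exact: continuous_dotp.
pose D := phi 0.
have D0 : 0 <= D by exact: dotp_ge0.
(* [phi y <= D] forces [c^2 |y|^2 <= 4 D]; adding 1 gives [rho <= rho^2]. *)
pose rho := 4 * D / c ^+ 2 + 1.
have c20 : 0 < c ^+ 2 by rewrite exprn_gt0.
have rho1 : 1 <= rho by rewrite lerDr divr_ge0 ?mulr_ge0// ltW.
pose A : set 'rV[R]_d := [set v | forall i : 'I_d, `[- rho, rho]%classic (v ord0 i)].
have A0 : A 0 by move=> i; rewrite /= mxE in_itv/=; apply/andP; split; lra.
have [x xA xmin] := @EVT_min_rV R d phi A (ex_intro _ 0 A0)
  (rV_compact (fun i => @segment_compact R (- rho) rho)) (continuous_subspaceT cphi).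
have gmin y : phi x <= phi y.
  have [yA|yA] := pselect (A y); first by apply: xmin; rewrite inE.
  apply: (@le_trans _ _ D); first by apply: xmin; rewrite inE.
  rewrite leNgt; apply/negP => yD.
  have [i yi] : exists i, rho < `|y 0 i|.
    move/existsNP : yA => [i /negP]; rewrite /= in_itv/= -ler_norml -ltNge => ?.
    by exists i.
  have yy : 4 * D / c ^+ 2 < dotp y y.
    apply: lt_le_trans (sqr_coord_le_dotp y i).
    rewrite -(ger0_norm (sqr_ge0 (y 0 i))) normrX.
    apply: (@lt_le_trans _ _ rho); first by rewrite /rho ltrDl.
    by apply: le_trans (ltW yi) _; rewrite expr2 ler_peMr// ltW// (le_lt_trans rho1).
  move: yy; rewrite ltr_pdivrMr// => yy.
  have := mono y 0; rewrite subr0 => m1.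
  have m2 := dotp_young y (h y - h 0) c0.
  have m3 : dotp (h y - h 0) (h y - h 0) <= 2 * phi y + 2 * D.
    have -> : h y - h 0 = (h y - b) - (h 0 - b) by rewrite opprB addrA subrK.
    have := dotp_ge0 ((h y - b) + (h 0 - b)).
    rewrite /phi /D /phi; move: (h y - b) (h 0 - b) => p p'.
    by rewrite !dotpE (dotpC p' p); lra.
  have m4 : c ^+ 2 * dotp y y <= dotp (h y - h 0) (h y - h 0).
    rewrite expr2 -mulrA -ler_pdivlMl// mulrC.
    move: m1 m2; rewrite (dotpC y); lra.
  move: yD yy m3 m4; rewrite mulrC; lra.
exists x; apply/eqP; rewrite -subr_eq0; apply/eqP.
apply: dotp_eq0; rewrite -/(phi x).
have [K HK] := loc x.
set v := h x - b; set V := dotp v v.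
have V0 : 0 <= V by exact: dotp_ge0.
have VE : dotp v v = V by [].
clearbody V.
change (dotp v v = 0); rewrite VE.
apply/eqP; rewrite eq_le V0 andbT leNgt; apply/negP => Vgt0.
pose K' := `|K| + 1.
have K'0 : 0 < K' by rewrite ltr_wpDl.
(* The first bound on the step makes the decrease win over the quadratic error, the
   second keeps the step inside the unit ball where [K] is valid. *)
pose tau := Num.min (c / K') (1 + V)^-1.
have V1 : 0 < 1 + V by lra.
have tau0 : 0 < tau by rewrite lt_min divr_gt0//= invr_gt0.
have tauK : K' * tau <= c by rewrite mulrC -ler_pdivlMr// ge_min lexx.
have tauV : tau * (1 + V) <= 1 by rewrite -ler_pdivlMr// mul1r ge_min lexx orbT.
clearbody tau.
pose y := x - tau *: v.
have yx : y - x = - (tau *: v) by rewrite /y addrC addKr.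
have dyx : dotp (y - x) (y - x) = tau ^+ 2 * V.
  by rewrite yx dotpNl dotpNr opprK dotpZl dotpZr expr2 mulrA VE.
have small : tau ^+ 2 * V <= 1.
  have tV : tau * V <= 1 by move: tauV; rewrite mulrDr mulr1; lra.
  have t1 : tau <= 1.
    by move: tauV; rewrite mulrDr mulr1; apply: le_trans; rewrite lerDl mulr_ge0// ltW.
  by rewrite expr2 -mulrA mulr_ile1// ?mulr_ge0// ltW.
have := HK y; rewrite dyx => /(_ small) HKy.
have := mono y x; rewrite dyx yx !(dotpNr, dotpZr) => my.
have := gmin y; apply/negP; rewrite -ltNge /phi.
have -> : h y - b = (h y - h x) + v by rewrite /v addrA subrK.
have dotpD2 (p q : 'rV[R]_d) : dotp (p + q) (p + q) = dotp q q + 2 * dotp p q + dotp p p.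
  by rewrite dotpDl !dotpDr (dotpC q p); ring.
rewrite dotpD2 -/v VE.
move: HKy my; move: (dotp (h y - h x) (h y - h x)) (dotp (h y - h x) v) => pp pv HKy my.
have Kle : K * (tau ^+ 2 * V) <= K' * (tau ^+ 2 * V).
  apply: ler_wpM2r; first by rewrite mulr_ge0// sqr_ge0.
  by apply: (@le_trans _ _ `|K|); [exact: ler_norm|rewrite /K' lerDl].
have pvV : pv <= - (c * tau * V).
  rewrite -(ler_pM2l tau0); move: my; rewrite expr2 => my; lra.
have tV0 : 0 < tau * V by rewrite mulr_gt0.
have ctV : 0 < c * (tau * V) by rewrite mulr_gt0.
have KtV : (K' * tau) * (tau * V) <= c * (tau * V) by rewrite ler_pM2r.
rewrite expr2 in HKy Kle; lra.
Qed.

End Euclid.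

(** * Pathwise estimates for the implicit step *)

Section SSBEPathwise.
Context {R : realType} {d m : nat}.
Variables (T L eta q hbar : R).
Variables (f : R -> 'rV[R]_d -> 'rV[R]_d) (g : 'I_m -> R -> 'rV[R]_d -> 'rV[R]_d).
Hypothesis m_gt0 : (0 < m)%N.
Hypothesis fg_adm : admissible T L eta q f g.
Hypothesis hbar_ltL : hbar < L^-1.
Variables (t delta : R).
Hypotheses (t_in : 0 <= t <= T) (delta_gt0 : 0 < delta) (delta_le : delta <= hbar).

Let L_gt0 : 0 < L := adm_L fg_adm.
Let eta_gt0 : 0 < eta.
Proof. by apply: lt_trans (adm_eta fg_adm); rewrite invr_gt0. Qed.

Lemma stepsize_contraction : 0 < 1 - hbar * L /\ 1 - hbar * L <= 1 - delta * L.
Proof.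
split; last by rewrite lerD2l lerN2 ler_pM2r.
by rewrite subr_gt0 -ltr_pdivlMr// mul1r.
Qed.

Let c_gt0 : 0 < 1 - delta * L.
Proof. by have [h1 h2] := stepsize_contraction; exact: lt_le_trans h2. Qed.

(** Monotonicity of the implicit map is a rewriting of the coupled monotonicity of [f]
    and [g]; the [g]-term is kept because it will pay for the noise. *)
Lemma implicit_map_monotone (y1 y2 : 'rV[R]_d) :
  (1 - delta * L) * dotp (y1 - y2) (y1 - y2) +
    eta * delta * \sum_(r < m) dotp (g r t y1 - g r t y2) (g r t y1 - g r t y2)
  <= dotp (implicit_map f delta t y1 - implicit_map f delta t y2) (y1 - y2).
Proof.
have := adm_monotone fg_adm y1 y2 t_in; rewrite enorm_sqr.
under eq_bigr do rewrite enorm_sqr.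
rewrite -(ler_pM2l delta_gt0) => mono.
have -> : implicit_map f delta t y1 - implicit_map f delta t y2 =
    (y1 - y2) - delta *: (f t y1 - f t y2).
  by rewrite /implicit_map scalerBr; apply/rowP => i; rewrite !mxE; ring.
rewrite [in leRHS]dotpDl [in leRHS]dotpNl [in leRHS]dotpZl.
move: mono; move: (dotp (f t y1 - _) _) (dotp (y1 - y2) _) (\sum_(r < m) _) => a b e; lra.
Qed.

(** The Lipschitz bound on [f] grows polynomially, but on the unit ball around [x] all
    norms are at most [M]. *)
Lemma implicit_map_locally_lipschitz (x : 'rV[R]_d) : exists K, forall y,
  dotp (y - x) (y - x) <= 1 ->
  dotp (implicit_map f delta t y - implicit_map f delta t x)
       (implicit_map f delta t y - implicit_map f delta t x)
  <= K * dotp (y - x) (y - x).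
Proof.
pose M : R := Num.sqrt (2 * dotp x x + 2).
pose N : R := L * (1 + M `^ (q - 1) + M `^ (q - 1)).
have M20 : 0 <= 2 * dotp x x + 2 by have := dotp_ge0 x; lra.
have q1 : 0 <= q - 1 by rewrite subr_ge0 ltW// (adm_q fg_adm).
exists (2 + 2 * delta ^+ 2 * N ^+ 2) => y yx.
have yM : enorm y <= M.
  by rewrite ler_sqrt//; have := dotp_double y x; lra.
have xM : enorm x <= M by rewrite ler_sqrt//; have := dotp_ge0 x; lra.
have fN : dotp (f t y - f t x) (f t y - f t x) <= N ^+ 2 * dotp (y - x) (y - x).
  rewrite -!enorm_sqr -exprMn lerXn2r ?nnegrE ?enorm_ge0//.
    by rewrite /N mulr_ge0 ?enorm_ge0// mulr_ge0 ?(ltW L_gt0)// !addr_ge0// powR_ge0.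
  have := adm_lipschitz fg_adm y x (Ordinal m_gt0) t_in.
  rewrite ge_max => /andP[+ _] => /le_trans; apply.
  rewrite ler_wpM2r ?enorm_ge0// ler_wpM2l ?(ltW L_gt0)//.
  by apply: lerD; [apply: lerD => //|]; apply: ge0_ler_powR;
    rewrite ?nnegrE ?enorm_ge0 ?sqrtr_ge0.
have -> : implicit_map f delta t y - implicit_map f delta t x =
    (y - x) - delta *: (f t y - f t x).
  by rewrite /implicit_map scalerBr; apply/rowP => i; rewrite !mxE; ring.
move: fN; move: (y - x) (f t y - f t x) => z v fN.
have := dotp_ge0 (z + delta *: v); rewrite !dotpE (dotpC v z) => pos.
have d2 : delta ^+ 2 * dotp v v <= delta ^+ 2 * (N ^+ 2 * dotp z z).
  by rewrite ler_wpM2l// sqr_ge0.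
rewrite expr2 in d2 *; lra.
Qed.

Lemma implicit_invK (x : 'rV[R]_d) : implicit_map f delta t (implicit_inv f delta t x) = x.
Proof.
apply: (xgetPex 0 (P := [set y | implicit_map f delta t y = x])).
apply: (strongly_monotone_surjective c_gt0 _ implicit_map_locally_lipschitz).
move=> y1 y2; apply: le_trans (implicit_map_monotone y1 y2).
rewrite lerDl !mulr_ge0 ?(ltW eta_gt0) ?(ltW delta_gt0)//.
by apply: sumr_ge0 => r _; exact: dotp_ge0.
Qed.

Section TwoPoints.
Variables x1 x2 : 'rV[R]_d.
Let y1 := implicit_inv f delta t x1.
Let y2 := implicit_inv f delta t x2.
Let S := \sum_(r < m) dotp (g r t y1 - g r t y2) (g r t y1 - g r t y2).

Let S_ge0 : 0 <= S. Proof. by apply: sumr_ge0 => r _; exact: dotp_ge0. Qed.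

Let core : (1 - delta * L) * dotp (y1 - y2) (y1 - y2) + eta * delta * S
  <= dotp (x1 - x2) (y1 - y2).
Proof. by have := implicit_map_monotone y1 y2; rewrite !implicit_invK. Qed.

Lemma implicit_inv_lipschitz :
  dotp (y1 - y2) (y1 - y2) <= dotp (x1 - x2) (x1 - x2) / (1 - delta * L) ^+ 2.
Proof.
have := dotp_young (y1 - y2) (x1 - x2) c_gt0; rewrite (dotpC (y1 - y2)) => young.
have eS : 0 <= eta * delta * S by rewrite !mulr_ge0 ?(ltW eta_gt0) ?(ltW delta_gt0).
have : (1 - delta * L) * dotp (y1 - y2) (y1 - y2) <=
    dotp (x1 - x2) (x1 - x2) / (1 - delta * L) by move: core; lra.
by rewrite -ler_pdivlMl// mulrC expr2 invfM mulrA.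
Qed.

(** Young's inequality with weight 1 leaves [2 L delta |y1 - y2|^2] on the wrong side.  It
    is absorbed by the Lipschitz bound on the implicit inverse, which is uniform in
    [delta <= hbar]; absorbing it on the left would require [2 L delta < 1]. *)
Lemma ssbe_pathwise_stability :
  dotp (y1 - y2) (y1 - y2) + (2 * eta) * (delta * S)
  <= (1 + 2 * L / (1 - hbar * L) ^+ 2 * delta) * dotp (x1 - x2) (x1 - x2).
Proof.
have := dotp_young (x1 - x2) (y1 - y2) ltr01; rewrite mul1r divr1 => young.
have [h0 h1] := stepsize_contraction.
have : dotp (y1 - y2) (y1 - y2) <= dotp (x1 - x2) (x1 - x2) / (1 - hbar * L) ^+ 2.
  apply: le_trans implicit_inv_lipschitz _; apply: ler_wpM2l; first exact: dotp_ge0.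
  by rewrite lef_pV2 ?posrE ?exprn_gt0// lerXn2r// nnegrE ltW.
rewrite -(ler_pM2l (mulr_gt0 L_gt0 delta_gt0)) => lip.
move: core young lip.
move: (dotp (y1 - y2) (y1 - y2)) (dotp (x1 - x2) (x1 - x2)) (dotp (x1 - x2) (y1 - y2)) S.
move: ((1 - hbar * L) ^- 2) => c yy xx xy s co yo li.
by rewrite mulrDl mul1r; lra.
Qed.

(** Although [g] grows polynomially, its composition with the implicit inverse is
    globally Lipschitz: monotonicity controls [g] by the inner product of the increments
    of [delta f (y) = y - x] and of [y]. *)
Lemma diffusion_implicit_inv_lipschitz (r : 'I_m) :
  dotp (g r t y1 - g r t y2) (g r t y1 - g r t y2)
  <= ((1 + 2 * L / (1 - hbar * L) ^+ 2 * delta) / (2 * eta * delta))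
     * dotp (x1 - x2) (x1 - x2).
Proof.
rewrite mulrAC ler_pdivlMr ?mulr_gt0//.
apply: le_trans ssbe_pathwise_stability.
set dg := dotp (g r t y1 - g r t y2) _.
have -> : dg * (2 * eta * delta) = 0 + 2 * eta * (delta * dg) by ring.
apply: lerD; first exact: dotp_ge0.
rewrite ler_pM2l ?mulr_gt0// ler_pM2l// /S (bigD1 r)//= lerDl.
by apply: sumr_ge0 => k _; exact: dotp_ge0.
Qed.

End TwoPoints.
End SSBEPathwise.

(** * Integrable and square-integrable real functions *)

Section RealIntegrable.
Context {R : realType} {d : measure_display} {T : measurableType d}.
Variable mu : {measure set T -> \bar R}.
Implicit Types f g : T -> R.

Lemma integrable_measurable f : mu.-integrable setT (EFin \o f) -> measurable_fun setT f.
Proof. by move/integrableP => [/measurable_EFinP]. Qed.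

Lemma integrable_add f g : mu.-integrable setT (EFin \o f) ->
  mu.-integrable setT (EFin \o g) -> mu.-integrable setT (EFin \o (fun w => f w + g w)).
Proof.
move=> fi gi; apply: (eq_integrable measurableT _ _ _ (integrableD measurableT fi gi)).
by move=> x _; rewrite /= EFinD.
Qed.

Lemma integrable_scale (c : R) f : mu.-integrable setT (EFin \o f) ->
  mu.-integrable setT (EFin \o (fun w => c * f w)).
Proof.
move=> fi; apply: (eq_integrable measurableT _ _ _ (integrableZl measurableT c fi)).
by move=> x _; rewrite /= EFinM.
Qed.

Lemma integrable_sum_fun n (f : 'I_n -> T -> R) :
  (forall i, mu.-integrable setT (EFin \o f i)) ->
  mu.-integrable setT (EFin \o (fun w => \sum_(i < n) f i w)).
Proof.
move=> fi; have := integrable_sum measurableT (index_enum 'I_n) (P := xpredT)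
  (h := fun i => EFin \o f i) (fun i _ => fi i).
by apply: eq_integrable => // x _ /=; rewrite sumEFin.
Qed.

Lemma integrable_dominated f g : measurable_fun setT f ->
  (forall x, `|f x| <= g x) -> mu.-integrable setT (EFin \o g) ->
  mu.-integrable setT (EFin \o f).
Proof.
move=> mf fg; apply: le_integrable => //; first exact/measurable_EFinP.
by move=> x _; rewrite lee_fin (le_trans (fg x))// ler_norm.
Qed.

Lemma Rintegral_sum n (f : 'I_n -> T -> R) :
  (forall i, mu.-integrable setT (EFin \o f i)) ->
  \int[mu]_w (\sum_(i < n) f i w) = \sum_(i < n) \int[mu]_w f i w.
Proof.
elim: n f => [|n IH] f fi.
  under eq_Rintegral do rewrite big_ord0.
  by rewrite big_ord0 /Rintegral integral0.
under eq_Rintegral do rewrite big_ord_recl.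
rewrite RintegralD//; last by apply: (integrable_sum_fun (f := fun i => f (lift ord0 i))).
by rewrite big_ord_recl IH.
Qed.

Definition sq_integrable f :=
  measurable_fun setT f /\ mu.-integrable setT (EFin \o (fun w => f w ^+ 2)).

Lemma sq_integrable_mul f g : sq_integrable f -> sq_integrable g ->
  mu.-integrable setT (EFin \o (fun w => f w * g w)).
Proof.
move=> [mf fi] [mg gi].
apply: (integrable_dominated (g := fun w => f w ^+ 2 + g w ^+ 2)).
- exact: measurable_funM.
- by move=> x; rewrite ler_norml; apply/andP; split; nra.
- exact: integrable_add.
Qed.

Lemma sq_integrable_add f g : sq_integrable f -> sq_integrable g ->
  sq_integrable (fun w => f w + g w).
Proof.
move=> fs gs; have fg := sq_integrable_mul fs gs.
case: fs gs => [mf fi] [mg gi]; split; first exact: measurable_funD.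
have := integrable_add (integrable_add fi gi) (integrable_scale 2 fg).
by apply: eq_integrable => // x _ /=; congr EFin; ring.
Qed.

Lemma sq_integrable_scale (c : R) f : sq_integrable f -> sq_integrable (fun w => c * f w).
Proof.
move=> [mf fi]; split; first exact: measurable_funM.
by have := integrable_scale (c ^+ 2) fi; apply: eq_integrable => // x _ /=; rewrite exprMn.
Qed.

Lemma sq_integrable_sub f g : sq_integrable f -> sq_integrable g ->
  sq_integrable (fun w => f w - g w).
Proof.
move=> fs gs; have := sq_integrable_add fs (sq_integrable_scale (-1) gs).
by under eq_fun do rewrite mulN1r.
Qed.

Lemma sq_integrable_sum n (f : 'I_n -> T -> R) : (forall i, sq_integrable (f i)) ->
  sq_integrable (fun w => \sum_(i < n) f i w).
Proof.
elim: n f => [|n IH] f fs.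
  under eq_fun do rewrite big_ord0; split; first exact: measurable_cst.
  by apply: (eq_integrable measurableT _ _ _ (integrable0 _ _)) => //= x _; rewrite expr0n.
under eq_fun do rewrite big_ord_recl.
by apply: sq_integrable_add => //; apply: (IH (fun i => f (lift ord0 i))).
Qed.

Lemma sq_integrable_bounded_mul (c f : T -> R) (K : R) : measurable_fun setT c ->
  (forall w, `|c w| <= K) -> sq_integrable f -> sq_integrable (fun w => c w * f w).
Proof.
move=> mc cK [mf fi]; split; first exact: measurable_funM.
apply: (integrable_dominated (g := fun w => K ^+ 2 * f w ^+ 2)).
- by apply: measurable_funX; exact: measurable_funM.
- move=> w; rewrite ger0_norm ?sqr_ge0// exprMn ler_wpM2r ?sqr_ge0//.
  by rewrite -(real_normK (num_real (c w))) lerXn2r ?nnegrE ?(le_trans _ (cK w)).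
- exact: integrable_scale.
Qed.

End RealIntegrable.

Section SquareIntegrableProbability.
Context {R : realType} {d : measure_display} {T : measurableType d}.
Variable P : probability T R.

Lemma sq_integrable_cst (c : R) : sq_integrable P (fun=> c).
Proof.
split; first exact: measurable_cst.
rewrite (_ : _ \o _ = EFin \o cst (c ^+ 2)) //.
exact: finite_measure_integrable_cst.
Qed.

Lemma sq_integrable_integrable (f : T -> R) : sq_integrable P f ->
  P.-integrable setT (EFin \o f).
Proof.
move=> /(sq_integrable_mul (sq_integrable_cst 1)).
by apply: eq_integrable => // w _ /=; rewrite mul1r.
Qed.

End SquareIntegrableProbability.

(** * Moments of the centred normal law *)

Section NormalMoments.
Context {R : realType}.
Variable s : R.
Hypothesis s_gt0 : 0 < s.
Notation mu := (@lebesgue_measure R).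
Notation p := (normal_pdf 0 s).

(** The Radon-Nikodym derivative of the normal law is almost everywhere its density. *)
Lemma ge0_integral_normal_prob (f : R -> R) :
  measurable_fun setT f -> (forall x, 0 <= f x) ->
  (\int[normal_prob 0 s]_x (f x)%:E = \int[mu]_x (f x * p x)%:E)%E.
Proof.
move=> mf f0.
have numu := normal_prob_dominates (0 : R) s.
have mEf : measurable_fun setT (EFin \o f) by exact/measurable_EFinP.
rewrite -(Radon_Nikodym_SigmaFinite.change_of_variables
  numu (f := EFin \o f) _ measurableT mEf); last by move=> x; rewrite lee_fin.
have mp : measurable_fun setT (EFin \o p).
  by apply/measurable_EFinP; exact: measurable_normal_pdf.
under [RHS]eq_integral do rewrite EFinM.
apply: ae_eq_integral => //.
- apply: emeasurable_funM => //; apply: (measurable_int mu).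
  exact: Radon_Nikodym_SigmaFinite.f_integrable numu.
- exact: emeasurable_funM.
- apply: ae_eqe_mul2l; apply: integral_ae_eq => //.
    exact: Radon_Nikodym_SigmaFinite.f_integrable numu.
  move=> E _ mE.
  by rewrite -(Radon_Nikodym_SigmaFinite.f_integral numu).
Qed.

Lemma normal_pdfN (x : R) : p (- x) = p x.
Proof. by rewrite normal_pdfE ?gt_eqF// /normal_fun !subr0 sqrrN. Qed.

Lemma is_derive_normal_pdf (x : R) : is_derive x 1 p (- (x / s ^+ 2) * p x).
Proof.
have s0 : s != 0 by rewrite gt_eqF.
rewrite normal_pdfE//.
have -> : (fun y => normal_peak s * normal_fun 0 s y) =
  (normal_peak s \*: (expR \o (fun y : R => (- (s ^+ 2 *+ 2)^-1) *: (y ^+ 2)))).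
  apply/funext => y; rewrite /normal_fun/= subr0 /GRing.scale/=.
  by congr (_ * expR _); rewrite mulNr mulrC mulNr.
have -> : - (x / s ^+ 2) * (normal_peak s * normal_fun 0 s x) =
  normal_peak s *: (expR (- (s ^+ 2 *+ 2)^-1 *: x ^+ 2) *
                    (- (s ^+ 2 *+ 2)^-1 *: (x *+ 2))).
  rewrite /normal_fun subr0 /GRing.scale/=.
  rewrite (_ : - x ^+ 2 / (s ^+ 2 *+ 2) = - (s ^+ 2 *+ 2)^-1 * x ^+ 2); last first.
    by rewrite mulNr mulrC mulNr.
  by field.
apply: is_deriveZ; apply: is_derive1_comp; apply: is_deriveZ.
apply: is_derive_eq.
by rewrite /GRing.scale/= ?expr1 ?mulr1 ?mulr_natl.
Qed.


(** From [expR y >= y] with [y = n^2 / (2 s^2)] follows [n p(n) <= C / n]. *)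
Lemma cvg_nat_mul_normal_pdf : (n%:R * p n%:R) @[n --> \oo] --> (0 : R).
Proof.
have s0 : s != 0 by rewrite gt_eqF.
pose C := normal_peak s * (s ^+ 2 *+ 2).
apply: (@squeeze_cvgr _ _ _ _ (cst 0) (fun n : nat => C * n%:R^-1)).
- near=> n.
  have n0 : 0 < n%:R :> R by near: n; exact: nbhs_infty_gtr.
  rewrite mulr_ge0 ?normal_pdf_ge0//=.
  rewrite normal_pdfE// /normal_fun subr0.
  rewrite mulNr expRN mulrCA /C -(mulrA (normal_peak s)) ler_pM2l ?normal_peak_gt0//.
  have y0 : 0 < n%:R ^+ 2 / (s ^+ 2 *+ 2) :> R.
    by rewrite divr_gt0// ?mulrn_wgt0 ?exprn_gt0.
  have : (expR (n%:R ^+ 2 / (s ^+ 2 *+ 2)))^-1 <= (n%:R ^+ 2 / (s ^+ 2 *+ 2))^-1.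
    rewrite lef_pV2 ?posrE ?expR_gt0//.
    by apply: le_trans (expR_ge1Dx _); rewrite lerDr.
  move=> /(ler_wpM2l (ltW n0)) /le_trans; apply.
  by rewrite invf_div le_eqVlt; apply/orP; left; apply/eqP; field; rewrite gt_eqF.
- exact: cvg_cst.
- rewrite -[X in _ --> X](mulr0 C); apply: cvgM; first exact: cvg_cst.
  apply/gtr0_cvgV0; last exact: cvgr_idn.
  by near=> n; near: n; exact: nbhs_infty_gtr.
Unshelve. all: by end_near. Qed.

Lemma continuous_normal_pdf0 : continuous p.
Proof. by apply: continuous_normal_pdf; rewrite gt_eqF. Qed.

Let cvg_p (x : R) : p y @[y --> x] --> p x.
Proof. exact: continuous_normal_pdf0. Qed.

(** Integrate the derivative [x^2 p(x) - s^2 p(x)] of [- s^2 x p(x)]. *)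
Lemma integral_sqr_normal_pdf_itv (n : nat) : (0 < n)%N ->
  (\int[mu]_(x in `[0%R, n%:R]) (x ^+ 2 * p x)%:E =
   (s ^+ 2)%:E * \int[mu]_(x in `[0%R, n%:R]) (p x)%:E
   - (s ^+ 2 * (n%:R * p n%:R))%:E)%E.
Proof.
move=> n0; have s0 : s != 0 by rewrite gt_eqF.
have ip : mu.-integrable `[0%R, n%:R] (EFin \o p).
  by apply: integrableS (integrable_normal_pdf _ _).
pose F x := - (s ^+ 2 * (x * p x)).
have dF (x : R) : is_derive x 1 F (x ^+ 2 * p x - s ^+ 2 * p x).
  have := is_derive_normal_pdf x => dp.
  rewrite /F; apply: is_derive_eq.
  by rewrite /GRing.scale/=; field.
have cg : continuous (fun x : R => x ^+ 2 * p x - s ^+ 2 * p x).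
  move=> x; apply: cvgB; apply: cvgM; try exact: cvg_p; last exact: cvg_cst.
  exact: exprn_continuous.
have FE : (F n%:R)%:E = (- (s ^+ 2 * (n%:R * p n%:R)))%:E :> \bar R by [].
have := @continuous_FTC2 R (fun x : R => x ^+ 2 * p x - s ^+ 2 * p x) F 0 n%:R.
rewrite ltr0n n0 => /(_ isT) H.
have {H} := H (continuous_subspaceT cg) => H.
have {H} : (\int[mu]_(x in `[0%R, n%:R%R]) (x ^+ 2 * p x - s ^+ 2 * p x)%R%:E)%E
   = ((F n%:R)%:E - (F 0)%:E)%E.
  have cF : continuous F.
    by move=> x; have [dx _] := dF x; apply/differentiable_continuous/derivable1_diffP.
  apply: H.
    split => //.
    - by apply: cvg_at_right_filter; exact: cF.
    - by apply: cvg_at_left_filter; exact: cF.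
  by move=> x _; rewrite derive1E; have [_ ->] := dF x.
rewrite FE {1}/F mul0r mulr0 oppr0 sube0 => I.
have -> : ((s ^+ 2)%:E * \int[mu]_(x in `[0%R, n%:R%R]) (p x)%:E =
          \int[mu]_(x in `[0%R, n%:R%R]) (s ^+ 2 * p x)%:E)%E.
  by rewrite -integralZl.
rewrite -EFinN -I -integralD//=; last 2 first.
- exact: (integrableZl _ (s ^+ 2) ip).
- apply: continuous_compact_integrable; first exact: segment_compact.
  exact: continuous_subspaceT.
by apply: eq_integral => x _; rewrite -EFinD subrKC.
Qed.

(** By evenness it suffices to integrate over the half-line, where the previous formula
    passes to the limit and its boundary term vanishes. *)
Lemma normal_prob_mean_sqr :
  (\int[normal_prob 0 s]_x (x ^+ 2)%:E = (s ^+ 2)%:E)%E.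
Proof.
have s0 : s != 0 by rewrite gt_eqF.
have mp := measurable_normal_pdf 0 s.
have msq : measurable_fun setT (fun x : R => x ^+ 2 * p x).
  by apply: measurable_funM => //; exact: measurable_funX.
have sq0 (x : R) : 0 <= x ^+ 2 * p x by rewrite mulr_ge0 ?sqr_ge0 ?normal_pdf_ge0.
have csq : continuous (fun x : R => x ^+ 2 * p x).
  by move=> x; apply: cvgM; [exact: exprn_continuous|exact: cvg_p].
rewrite (@ge0_integral_normal_prob (fun x => x ^+ 2)); last 2 first.
- exact: measurable_funX.
- by move=> x; exact: sqr_ge0.
have half (f : R -> R) : (forall x, 0 <= f x) -> continuous f ->
    (forall x, f (- x) = f x) ->
    (\int[mu]_x (f x)%:E = 2%:E * \int[mu]_(x in `[0%R, +oo[) (f x)%:E)%E.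
  move=> f0 cf fN; rewrite ge0_symfun_integralT//; first by rewrite set_itvcy.
  by move=> x; rewrite /= fN.
have <- : (\int[mu]_x (s ^+ 2 * p x)%:E = (s ^+ 2)%:E)%E.
  under eq_integral do rewrite EFinM.
  rewrite integralZl//; last exact: integrable_normal_pdf.
  by rewrite integral_normal_pdf mule1.
rewrite (half (fun x => x ^+ 2 * p x))//; last first.
  by move=> x; rewrite normal_pdfN sqrrN.
rewrite (half (fun x => s ^+ 2 * p x)); last 3 first.
- by move=> x; rewrite mulr_ge0 ?sqr_ge0 ?normal_pdf_ge0.
- by move=> x; apply: cvgM; [exact: cvg_cst|exact: cvg_p].
- by move=> x; rewrite normal_pdfN.
congr (_ * _)%E.
apply: (cvg_unique _ (ge0_cvgn_integral (mu := mu) sq0 msq)).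
  exact: ereal_hausdorff.
have H0 : ((s ^+ 2 * (n%:R * p n%:R))%:E @[n --> \oo] --> 0%:E)%E.
  apply: cvg_EFin; first by near=> n.
  rewrite -[X in _ --> X](mulr0 (s ^+ 2)).
  by apply: cvgM; [exact: cvg_cst|exact: cvg_nat_mul_normal_pdf].
have msp : measurable_fun setT (fun x : R => s ^+ 2 * p x).
  exact: measurable_funM.
have sp0 (x : R) : 0 <= s ^+ 2 * p x by rewrite mulr_ge0 ?sqr_ge0 ?normal_pdf_ge0.
set l := (\int[mu]_(x in `[0%R, +oo[) (s ^+ 2 * p x)%:E)%E.
have hl : (l +? - 0%:E)%E by rewrite fin_num_adde_defl.
have := cvgeB hl (ge0_cvgn_integral (mu := mu) sp0 msp) H0.
rewrite sube0; move=> /(_ (@eventually_filter)); apply: cvg_trans.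
apply: near_eq_cvg; near=> n.
rewrite integral_sqr_normal_pdf_itv; last by near: n; exact: nbhs_infty_gt.
congr (_ - _)%E; rewrite -integralZl//.
by apply: integrableS (integrable_normal_pdf _ _).
Unshelve. all: by end_near. Qed.

Lemma normal_prob_integrable_sqr :
  (normal_prob 0 s).-integrable setT (EFin \o (fun x : R => x ^+ 2)).
Proof.
apply/integrableP; split; first by apply/measurable_EFinP; exact: measurable_funX.
under eq_integral do rewrite /= ger0_norm ?sqr_ge0//.
by rewrite normal_prob_mean_sqr// ltry.
Qed.

Lemma normal_prob_integrable_id :
  (normal_prob 0 s).-integrable setT (EFin \o (fun x : R => x)).
Proof.
have i1 : (normal_prob 0 s).-integrable setT (EFin \o (cst 1 : R -> R)).
  exact: finite_measure_integrable_cst.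
apply: (integrable_dominated _ _ (integrable_add i1 normal_prob_integrable_sqr)) => // x.
by rewrite /= ler_norml; apply/andP; split; nra.
Qed.

(** The reflection [x |-> - x] exchanges the positive and negative parts of the identity,
    whose integrals are finite. *)
Lemma normal_prob_mean : (\int[normal_prob 0 s]_x x%:E = 0)%E.
Proof.
have s0 : s != 0 by rewrite gt_eqF.
have mp := measurable_normal_pdf 0 s.
have iid := normal_prob_integrable_id.
rewrite integralE.
have posE : (fun x : R => x%:E)^\+%E = (fun x : R => (Num.max x 0)%:E).
  by apply/funext => x; rewrite funeposE EFin_max.
have negE : (fun x : R => x%:E)^\-%E = (fun x : R => (Num.max (- x) 0)%:E).
  by apply/funext => x; rewrite funenegE EFin_max.
have mmax : measurable_fun setT (fun x : R => Num.max x 0) by exact: measurable_maxr.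
have mmin : measurable_fun setT (fun x : R => Num.max (- x) 0).
  by apply: measurable_maxr => //; exact: measurable_funN.
have max_ge0 (x : R) : 0 <= Num.max x 0 by rewrite le_max lexx orbT.
suff -> : (\int[normal_prob 0 s]_x ((fun x : R => x%:E)^\-%E) x =
    \int[normal_prob 0 s]_x ((fun x : R => x%:E)^\+%E) x)%E.
  by rewrite subee// integrable_pos_fin_num.
rewrite posE negE.
rewrite (@ge0_integral_normal_prob (fun x => Num.max (- x) 0))//.
rewrite (@ge0_integral_normal_prob (fun x => Num.max x 0))//.
have -> : (\int[mu]_x (Num.max (- x) 0 * p x)%:E =
  \int[mu]_(x in `]-oo, (- 0)%R]) (Num.max (- x) 0 * p x)%:E)%E.
  rewrite [RHS]integral_mkcond; apply: eq_integral => x _.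
  rewrite patchE; case: ifPn => //; rewrite notin_setE/= in_itv/= oppr0.
  move/negP; rewrite -ltNge => x0.
  by rewrite max_r ?mul0r// oppr_le0 ltW.
rewrite ge0_integration_by_substitutionNy.
- rewrite [RHS](_ : _ = \int[mu]_(x in `[0%R, +oo[) (Num.max x 0 * p x)%:E)%E.
    by apply: eq_integral => x _; rewrite /= opprK normal_pdfN.
  rewrite [RHS]integral_mkcond; apply: eq_integral => x _.
  rewrite patchE; case: ifPn => //; rewrite notin_setE/= in_itv/= andbT.
  move/negP; rewrite -ltNge => x0.
  by rewrite max_r ?mul0r// ltW.
- apply: continuous_subspaceT => x; apply: cvgM; last exact: continuous_normal_pdf0.
  by apply: continuous_max; [exact: cvgN|exact: cvg_cst].
- by move=> x _; rewrite mulr_ge0 ?normal_pdf_ge0.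
Qed.
End NormalMoments.

Section NormalLaw.
Context {R : realType} {dO : measure_display} {Omega : measurableType dO}.
Variable P : probability Omega R.
Variables (s : R) (X : Omega -> R).
Hypotheses (s_gt0 : 0 < s) (mX : measurable_fun setT X).
Hypothesis lawX : forall B : set R, measurable B -> P (X @^-1` B) = normal_prob 0 s B.

Let mX' : @measurable_fun _ _ _ (measurableTypeR R) setT X := mX.

Let mfX : {mfun Omega >-> measurableTypeR R} :=
  @mfun_Sub _ _ Omega (measurableTypeR R) X (mem_set mX').

Let lawE (f : measurableTypeR R -> \bar R) :
  (\int[distribution P mfX]_x f x = \int[normal_prob 0 s]_x f x)%E.
Proof. by apply: eq_measure_integral => A mA _; exact: lawX. Qed.

Let integrable_law (f : R -> R) : measurable_fun setT f ->
  (normal_prob 0 s).-integrable setT (EFin \o f) ->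
  P.-integrable setT (EFin \o (f \o X)).
Proof.
move=> mf /integrableP[_ fi]; apply/integrableP; split.
  by apply/measurable_EFinP; exact: measurableT_comp.
have := @ge0_integral_distribution _ _ _ _ _ P mfX (fun x => `|(f x)%:E|)%E.
move=> /(_ _ _)/= <-//; first by rewrite lawE.
by apply/measurable_EFinP; exact: measurableT_comp.
Qed.

Lemma normal_integrable_sqr : P.-integrable setT (EFin \o (fun w => X w ^+ 2)).
Proof.
apply: (integrable_law (f := fun x => x ^+ 2)); first exact: measurable_funX.
exact: normal_prob_integrable_sqr.
Qed.

Lemma normal_integrable : P.-integrable setT (EFin \o X).
Proof. by apply: (integrable_law (f := id)) => //; exact: normal_prob_integrable_id. Qed.

Lemma normal_mean : \int[P]_w X w = 0.
Proof.
rewrite /Rintegral.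
have := @integral_distribution _ _ _ _ _ P mfX (EFin \o id).
move=> /(_ _ _)/= <-//; first by rewrite lawE normal_prob_mean.
- by apply/measurable_EFinP; exact: measurable_id.
- exact: normal_integrable.
Qed.

Lemma normal_mean_sqr : \int[P]_w (X w ^+ 2) = s ^+ 2.
Proof.
rewrite /Rintegral.
have := @integral_distribution _ _ _ _ _ P mfX (EFin \o (fun x => x ^+ 2)).
move=> /(_ _ _)/= <-//; first by rewrite lawE normal_prob_mean_sqr.
- by apply/measurable_EFinP; exact: measurable_funX.
- exact: normal_integrable_sqr.
Qed.

End NormalLaw.

(** * Products of independent random variables *)

Section Independence.
Context {R : realType} {d : measure_display} {T : measurableType d}.
Variable P : probability T R.
Implicit Types X Y : T -> R.

Definition indep_var X Y := forall A B : set R, measurable A -> measurable B ->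
  P (X @^-1` A `&` Y @^-1` B) = (P (X @^-1` A) * P (Y @^-1` B))%E.

Section Product.
Variables X Y : T -> R.
Hypotheses (mX : measurable_fun setT X) (mY : measurable_fun setT Y).
Hypothesis XY : indep_var X Y.

Let Xf : {mfun T >-> R} := mfun_Sub (mem_set mX).
Let Yf : {mfun T >-> R} := mfun_Sub (mem_set mY).
Let Zf : {mfun T >-> (R * R)%type} := mfun_Sub (mem_set (measurable_fun_pair mX mY)).
Let PX : probability R R := distribution P Xf.
Let PY : probability R R := distribution P Yf.
Let PZ : probability (R * R)%type R := distribution P Zf.

(** Independence says that the joint law and the product law agree on rectangles, which
    generate. *)
Let integral_joint (f : (R * R)%type -> \bar R) :
  (\int[PZ]_z f z = \int[(PX \x PY)%E]_z f z)%E.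
Proof.
apply: eq_measure_integral => A mA _; apply/esym.
by apply: product_measure_unique => // B C mB mC; exact: XY.
Qed.

Hypotheses (iX : P.-integrable setT (EFin \o X)) (iY : P.-integrable setT (EFin \o Y)).

Let mM : measurable_fun setT (fun z : (R * R)%type => z.1 * z.2).
Proof. by apply: measurable_funM; [exact: measurable_fst|exact: measurable_snd]. Qed.

Let integral_abs_joint :
  (\int[P]_w `|X w * Y w|%:E = (\int[P]_w `|X w|%:E) * (\int[P]_w `|Y w|%:E))%E.
Proof.
have mabs : measurable_fun setT (fun z : (R * R)%type => (`|z.1 * z.2|)%:E).
  by apply/measurable_EFinP; exact: measurableT_comp.
have mn : measurable_fun setT (fun x : R => `|x|%:E).
  by apply/measurable_EFinP; exact: (@normr_measurable R setT).
have EX := ge0_integral_distribution (P := P) Xf mn (fun z => normr_ge0 z).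
have EY := ge0_integral_distribution (P := P) Yf mn (fun z => normr_ge0 z).
have EZ := ge0_integral_distribution (P := P) Zf mabs (fun z => normr_ge0 (z.1 * z.2)).
rewrite -[LHS]EZ -[X in (X * _)%E]EX -[X in (_ * X)%E]EY.
rewrite integral_joint fubini_tonelli1//= /fubini_F/=.
rewrite -ge0_integralZr//; last exact: integral_ge0.
apply: eq_integral => x _; rewrite -ge0_integralZl_EFin//.
by apply: eq_integral => y _; rewrite normrM EFinM.
Qed.

Lemma indep_integrable_mul : P.-integrable setT (EFin \o (fun w => X w * Y w)).
Proof.
apply/integrableP; split.
  by apply/measurable_EFinP; exact: measurable_funM.
rewrite [ltLHS](_ : _ = \int[P]_w `|X w * Y w|%:E)%E// integral_abs_joint.
move/integrableP : iX => [_ iX']; move/integrableP : iY => [_ iY'].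
by rewrite lte_mul_pinfty// ?integral_ge0// ge0_fin_numE// integral_ge0.
Qed.

Lemma indep_Rintegral_mul : \int[P]_w (X w * Y w) = (\int[P]_w X w) * (\int[P]_w Y w).
Proof.
have iXY := indep_integrable_mul.
have mME : measurable_fun setT (fun z : (R * R)%type => (z.1 * z.2)%:E).
  exact/measurable_EFinP.
have EZ := integral_distribution (P := P) (X := Zf) mME iXY.
have iPZ : (PX \x PY)%E.-integrable setT (fun z : (R * R)%type => (z.1 * z.2)%:E).
  apply/integrableP; split => //; rewrite -integral_joint.
  have mabs : measurable_fun setT (fun z : (R * R)%type => `|(z.1 * z.2)%:E|%E).
    exact: measurableT_comp.
  rewrite (ge0_integral_distribution (P := P) Zf mabs (fun z => abse_ge0 _)).
  by move/integrableP : iXY => [].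
have mid : measurable_fun setT (fun x : R => x%:E).
  by apply/measurable_EFinP; exact: measurable_id.
have EX := integral_distribution (P := P) (X := Xf) mid iX.
have EY := integral_distribution (P := P) (X := Yf) mid iY.
have iPY : PY.-integrable setT (fun y : R => y%:E).
  apply/integrableP; split => //.
  have mabs : measurable_fun setT (fun y : R => `|y%:E|%E) by exact: measurableT_comp.
  rewrite (ge0_integral_distribution (P := P) Yf mabs (fun z => abse_ge0 _)).
  by move/integrableP : iY => [].
have iPX : PX.-integrable setT (fun y : R => y%:E).
  apply/integrableP; split => //.
  have mabs : measurable_fun setT (fun y : R => `|y%:E|%E) by exact: measurableT_comp.
  rewrite (ge0_integral_distribution (P := P) Xf mabs (fun z => abse_ge0 _)).
  by move/integrableP : iX => [].
rewrite /Rintegral -fineM; [|exact: integrable_fin_num..].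
congr fine; rewrite -[LHS]EZ -[X in (X * _)%E]EX -[X in (_ * X)%E]EY.
rewrite [LHS]integral_joint -integral12_prod_meas1//= /fubini_F/=.
under eq_integral do under eq_integral do rewrite EFinM.
under eq_integral do rewrite integralZl//.
have /fineK fY := integrable_fin_num measurableT iPY.
rewrite -[X in (_ = _ * X)%E]fY; under eq_integral do rewrite -fY.
by rewrite integralZr.
Qed.
End Product.

End Independence.

(** * Measurability with respect to a sub-sigma-algebra *)

Section MeasurableWrt.
Context {dO : measure_display} {Omega : measurableType dO}.
Variable G : set_system Omega.
Hypothesis sG : sigma_algebra setT G.

Let OmG := g_sigma_algebraType G.

Lemma measurable_sigmaE (A : set Omega) : @measurable _ OmG A = G A.
Proof. by rewrite [@measurable _ OmG]measurable_g_measurableTypeE. Qed.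

Lemma measurable_wrt_comp (E E' : topologicalType) (h : E -> E') (X : Omega -> E) :
  continuous h -> measurable_wrt G X -> measurable_wrt G (h \o X).
Proof.
move=> ch mX B; apply: (smallest_sub (X := [set B | G (X @^-1` (h @^-1` B))])).
- have [G0 GC GU] := sG; split => /=.
  + by rewrite !preimage_set0.
  + by move=> A GA; rewrite setTD; have := GC _ GA; rewrite setTD.
  + by move=> A GA; rewrite !preimage_bigcup; exact: GU.
- move=> U oU /=; apply: mX; apply: sub_sigma_algebra => /=.
  by move/continuousP : ch; exact.
Qed.

Context {R : realType}.

Lemma borel_measurable : @borel R = @measurable _ R.
Proof.
apply/seteqP; split.
- apply: smallest_sub; first exact: sigma_algebra_measurable.
  by move=> U /= oU; exact: open_measurable.
- have -> : @measurable _ R = (@RGenOpens.G R).-sigma.-measurable.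
    exact: RGenOpens.measurableE.
  apply: smallest_sub; first exact: smallest_sigma_algebra.
  by move=> _ [a [b ->]]; apply: sub_sigma_algebra => /=; exact: interval_open.
Qed.

Lemma measurable_wrt_funP (X : Omega -> R) :
  measurable_wrt G X <-> measurable_fun (setT : set OmG) X.
Proof.
split => [mX _ B mB|mX B bB].
- by rewrite setTI measurable_sigmaE; apply: mX; rewrite borel_measurable.
- rewrite -measurable_sigmaE -[X in measurable X]setTI; apply: mX => //.
  by rewrite -borel_measurable.
Qed.

(** Second countability of the space of row vectors, by boxes with rational centres; the
    union is indexed by all codes of pairs (centre, radius), irrelevant codes giving the
    empty set. *)
Lemma open_rV_bigcup_box d (U : set 'rV[R]_d) : open U ->
  let box (c : 'rV[rat]_d) (k : nat) :=
    [set x : 'rV[R]_d | forall i, `|x 0 i - ratr (c 0 i)| < k.+1%:R^-1] in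
  U = \bigcup_(n in [set: nat]) (if unpickle n is Some (c, k) then
    if `[< box c k `<=` U >] then box c k else set0 else set0).
Proof.
move=> oU box; apply/seteqP; split => [x Ux|x [n _]]; last first.
  by case: unpickle => // -[c k]; case: asboolP => // cU /cU.
have : nbhs x U by exact: open_nbhs_nbhs.
move/nbhs_ballP => [e /= e0 eU].
have [k ke] : exists k : nat, 2 * k.+1%:R^-1 < e.
  have e2 : 0 < e / 2 by rewrite divr_gt0.
  have [k ke] := @ltr_add_invr R 0 (e / 2) e2.
  by exists k; rewrite -ltr_pdivlMl// mulrC; rewrite add0r in ke.
have H i : exists q : rat, `|x 0 i - ratr q| < k.+1%:R^-1.
  have k0 : (0 : R) < k.+1%:R^-1 by rewrite invr_gt0.
  have xk : x 0 i - k.+1%:R^-1 < x 0 i + k.+1%:R^-1.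
    by rewrite ltrBlDr -addrA ltrDl addr_gt0.
  have [q] := rat_in_itvoo xk.
  by rewrite in_itv/= => /andP[q1 q2]; exists q; rewrite ltr_distlC q1 q2.
have [c cP] := choice H.
exists (pickle (\row_i c i, k)) => //; rewrite pickleK.
case: asboolP => [_ i|]; first by rewrite mxE.
case; move=> y yc; apply: eU; split => // i j; rewrite !ord1 /ball/=.
have := yc j; have := cP j; rewrite mxE !ltr_norml.
move: (k.+1%:R^-1) ke => r ke /andP[? ?] /andP[? ?]; apply/andP; split; lra.
Qed.

(** Reduces vector-valued measurability to that of the coordinates, for which the closure
    properties of real measurable functions are available. *)
Lemma measurable_wrt_rVP d (X : Omega -> 'rV[R]_d) :
  measurable_wrt G X <-> forall i, measurable_wrt G (fun w => X w 0 i).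
Proof.
split => [mX i|mX B].
  apply: (measurable_wrt_comp (h := fun x : 'rV[R]_d => x 0 i)) => //.
  exact: coord_continuous.
apply: (smallest_sub (X := [set B | G (X @^-1` B)])).
- have [G0 GC GU] := sG; split => /=.
  + by rewrite !preimage_set0.
  + by move=> A GA; rewrite setTD; have := GC _ GA; rewrite setTD.
  + by move=> A GA; rewrite !preimage_bigcup; exact: GU.
- move=> U /= oU; rewrite (open_rV_bigcup_box oU) preimage_bigcup -measurable_sigmaE.
  apply: bigcupT_measurable => n.
  case: unpickle => [[c k]|]; last by rewrite preimage_set0.
  case: asboolP => _; last by rewrite preimage_set0.
  rewrite [X in measurable X](_ : _ = \bigcap_(i in [set: 'I_d])
    ((fun w => X w 0 i) @^-1` ball (ratr (c 0 i) : R) (k.+1%:R^-1 : R))); last first.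
    apply/seteqP; split=> w /= H i; first by move=> _; rewrite /ball/= distrC; exact: H.
    by have := H i I; rewrite /ball/= distrC.
  apply: fin_bigcap_measurable => // i _; rewrite measurable_sigmaE; apply: mX.
  by apply: sub_sigma_algebra => /=; exact: ball_open.
Qed.

End MeasurableWrt.

(** * Brownian increments *)

Section Increments.
Context {R : realType} {dO : measure_display} {Omega : measurableType dO}.
Variable P : probability Omega R.
Implicit Types (X Y : Omega -> R).

Lemma measurable_wrt_measurable (G : set_system Omega) X :
  G `<=` measurable -> measurable_wrt G X -> measurable_fun setT X.
Proof.
move=> GM mX _ B mB; rewrite setTI; apply: GM; apply: mX.
by rewrite borel_measurable.
Qed.

Lemma measurable_wrt_mono (E : topologicalType) (G H : set_system Omega) (X : Omega -> E) :
  G `<=` H -> measurable_wrt G X -> measurable_wrt H X.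
Proof. by move=> GH mX B bB; apply: GH; exact: mX. Qed.

Lemma indep_var_sigma (G H : set_system Omega) X Y :
  (forall A B, G A -> H B -> P (A `&` B) = (P A * P B)%E) ->
  measurable_wrt G X -> measurable_wrt H Y -> indep_var P X Y.
Proof.
move=> GH mX mY A B mA mB; apply: GH.
- by apply: mX; rewrite borel_measurable.
- by apply: mY; rewrite borel_measurable.
Qed.

Variables (T : R) (F : R -> set_system Omega).
Hypothesis F_usual : usual_filtration P T F.

Section OneMotion.
Variable W : R -> Omega -> R.
Hypothesis W_bm : standard_brownian_motion P T F W.
Variables s t : R.
Hypotheses (s0 : 0 <= s) (st : s < t) (tT : t <= T).

Let s_in : 0 <= s <= T. Proof. by rewrite s0 (le_trans (ltW st)). Qed.
Let t_in : 0 <= t <= T. Proof. by rewrite tT andbT (le_trans s0 (ltW st)). Qed.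

Lemma increment_adapted : measurable_wrt (F t) (increment W s t).
Proof.
have sF := filtration_sigma F_usual t_in.
apply/(measurable_wrt_funP sF); apply: measurable_funB.
- by apply/(measurable_wrt_funP sF); exact: (bm_adapted W_bm).
- apply/(measurable_wrt_funP sF).
  apply: measurable_wrt_mono (bm_adapted W_bm s_in).
  by apply: (filtration_mono F_usual) => //; exact: ltW.
Qed.

Lemma measurable_increment : measurable_fun setT (increment W s t).
Proof. exact: measurable_wrt_measurable (filtration_sub F_usual t_in) increment_adapted. Qed.

Let sqrt_gt0 : 0 < Num.sqrt (t - s). Proof. by rewrite sqrtr_gt0 subr_gt0. Qed.

Lemma increment_sq_integrable : sq_integrable P (increment W s t).
Proof.
split; first exact: measurable_increment.
apply: (normal_integrable_sqr sqrt_gt0) => //; first exact: measurable_increment.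
exact: (bm_normal W_bm).
Qed.

Lemma increment_integrable : P.-integrable setT (EFin \o increment W s t).
Proof.
apply: (normal_integrable sqrt_gt0) => //; first exact: measurable_increment.
exact: (bm_normal W_bm).
Qed.

Lemma increment_mean : \int[P]_w increment W s t w = 0.
Proof.
apply: (normal_mean sqrt_gt0) => //; first exact: measurable_increment.
exact: (bm_normal W_bm).
Qed.

Lemma increment_mean_sqr : \int[P]_w (increment W s t w ^+ 2) = t - s.
Proof.
rewrite (normal_mean_sqr sqrt_gt0) //; last exact: (bm_normal W_bm).
- by rewrite sqr_sqrtr// subr_ge0 ltW.
- exact: measurable_increment.
Qed.

(** An increment is independent of every variable known at its left end point, hence
    moments of products factor. *)
Section Past.
Variable X : Omega -> R.
Hypothesis mX : measurable_wrt (F s) X.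

Let mX' : measurable_fun setT X.
Proof. exact: measurable_wrt_measurable (filtration_sub F_usual s_in) mX. Qed.

Let mI : measurable_fun setT (increment W s t) := measurable_increment.

Let indepI : indep_var P X (increment W s t).
Proof.
move=> A B mA mB; apply: (bm_indep W_bm) => //.
by apply: mX; rewrite borel_measurable.
Qed.

Let indepI2 : indep_var P (fun w => X w ^+ 2) (fun w => increment W s t w ^+ 2).
Proof.
move=> A B mA mB.
have msq (C : set R) : measurable C -> measurable ((fun x : R => x ^+ 2) @^-1` C).
  by move=> mC; rewrite -[_ @^-1` _]setTI; apply: measurable_funX.
exact: (indepI (msq _ mA) (msq _ mB)).
Qed.

Lemma past_increment_integrable : P.-integrable setT (EFin \o X) ->
  P.-integrable setT (EFin \o (fun w => X w * increment W s t w)).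
Proof. by move=> iX; apply: indep_integrable_mul => //; exact: increment_integrable. Qed.

Lemma past_increment_mean : P.-integrable setT (EFin \o X) ->
  \int[P]_w (X w * increment W s t w) = 0.
Proof.
move=> iX; rewrite indep_Rintegral_mul ?increment_mean ?mulr0//.
exact: increment_integrable.
Qed.

Lemma past_increment_sq_integrable : sq_integrable P X ->
  sq_integrable P (fun w => X w * increment W s t w).
Proof.
move=> [_ iX]; split; first exact: measurable_funM.
under eq_fun do rewrite exprMn.
by apply: (indep_integrable_mul _ _ indepI2) => //;
  [exact: measurable_funX..|case: increment_sq_integrable].
Qed.

Lemma past_increment_mean_sqr : sq_integrable P X ->
  \int[P]_w ((X w * increment W s t w) ^+ 2) = (t - s) * \int[P]_w (X w ^+ 2).
Proof.
move=> [_ iX]; under eq_Rintegral do rewrite exprMn.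
rewrite (indep_Rintegral_mul _ _ indepI2)//.
- by rewrite increment_mean_sqr mulrC.
- exact: measurable_funX.
- exact: measurable_funX.
- by case: increment_sq_integrable.
Qed.

End Past.
End OneMotion.

Section ProcessSigma.
Variable W : R -> Omega -> R.

Lemma process_sigma_algebra : sigma_algebra setT (process_sigma T W).
Proof. exact: smallest_sigma_algebra. Qed.

Lemma process_sigma_increment s t : 0 <= s <= T -> 0 <= t <= T ->
  measurable_wrt (process_sigma T W) (increment W s t).
Proof.
move=> s_in t_in.
have W_in u : 0 <= u <= T -> measurable_wrt (process_sigma T W) (W u).
  move=> u_in B bB; apply: sub_sigma_algebra => /=; exists u => //.
  by exists B => //; rewrite -borel_measurable.
apply/(measurable_wrt_funP process_sigma_algebra); apply: measurable_funB;
  by apply/(measurable_wrt_funP process_sigma_algebra); exact: W_in.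
Qed.
End ProcessSigma.

(** Complete the two events by [setT] to a family indexed by all the processes. *)
Lemma independent_processes_pair m (W : 'I_m -> R -> Omega -> R) (r r' : 'I_m) X Y :
  independent_processes P T W -> r != r' ->
  measurable_wrt (process_sigma T (W r)) X ->
  measurable_wrt (process_sigma T (W r')) Y -> indep_var P X Y.
Proof.
move=> iW rr'; apply: indep_var_sigma => A B GA GB.
pose C k := if k == r then A else if k == r' then B else setT.
have := iW C; have -> : \bigcap_(k in [set: 'I_m]) C k = A `&` B.
  apply/seteqP; split=> [w H|w [wA wB] k _]; last by rewrite /C; do 2?case: ifP.
  by split; [have := H r I|have := H r' I]; rewrite /C ?eqxx// eq_sym (negbTE rr').
move=> ->.
  rewrite (bigD1 r)//= (bigD1 r')//=; last by rewrite eq_sym.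
  rewrite big1 ?mule1; first by rewrite /C eqxx eq_sym (negbTE rr') eqxx.
  by move=> k /andP[kr kr']; rewrite /C (negbTE kr) (negbTE kr') probability_setT.
move=> k; rewrite /C; case: eqP => [->//|_]; case: eqP => [->//|_].
have [G0 GC _] := process_sigma_algebra (W k).
by have := GC _ G0; rewrite setTD setC0.
Qed.

End Increments.

(** * Orthogonality of the increments of two independent Brownian motions *)

(** Let [n] tend to infinity, then choose [l] proportional to [x]. *)
Lemma eq0_of_quadratic_bound (R : realType) (x A B : R) : 0 <= A -> 0 <= B ->
  (forall (n : nat) (l : R), (0 < n)%N -> 2 * l * x <= A / n%:R + l ^+ 2 * B) -> x = 0.
Proof.
move=> A0 B0 H.
have {}H l : 2 * l * x <= l ^+ 2 * B.
  rewrite leNgt; apply/negP; rewrite -subr_gt0 => gap.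
  pose e := (2 * l * x - l ^+ 2 * B) / (A + 1).
  have A1 : 0 < A + 1 by rewrite ltr_wpDl.
  have e0 : 0 < e by rewrite divr_gt0.
  have [k ke] := @ltr_add_invr R 0 e e0.
  move: ke; rewrite add0r /e ltr_pdivlMr// => ke.
  have := H k.+1 l isT.
  rewrite -lerBlDr leNgt => /negP; apply.
  by apply: le_lt_trans ke; rewrite mulrDr mulr1 mulrC lerDl invr_ge0.
have B1 : 0 < B + 1 by rewrite ltr_wpDl.
have := H (x / (B + 1)); rewrite -subr_ge0.
have -> : (x / (B + 1)) ^+ 2 * B - 2 * (x / (B + 1)) * x =
   - (x ^+ 2 * ((B + 2) / (B + 1) ^+ 2)) by field; rewrite gt_eqF.
rewrite oppr_ge0 pmulr_lle0; last by rewrite divr_gt0// ?exprn_gt0// ltr_wpDl.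
by move=> x0; apply/eqP; rewrite -sqrf_eq0 eq_le sqr_ge0 andbT.
Qed.

Lemma clamp_norm (R : realDomainType) (n c : R) : 0 <= n ->
  `|Num.max (- n) (Num.min n c)| <= `|c|.
Proof.
move=> n0; case: (leP n c) => nc.
  by rewrite max_r ?ger0_norm ?(le_trans n0)// ?ge0_cp.
case: (leP (- n) c) => // cn.
by rewrite normrN ger0_norm// ler0_norm; lra.
Qed.

Lemma clamp_id (R : realDomainType) (n c : R) : `|c| <= n ->
  Num.max (- n) (Num.min n c) = c.
Proof. by rewrite ler_norml => /andP[nc cn]; rewrite min_r// max_r. Qed.

(** Each of the two motions has increments independent of the past, and the two motions are
    independent of each other, but nothing is assumed about the joint law of both
    increments given the past: for arbitrary variables, independence of the past
    separately would not make the product of two increments orthogonal to it.  The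
    conclusion holds for processes because their bracket vanishes.  Splitting [[s, t]]
    into [n] pieces, the product of the two increments is the bracket sum [Q] of the
    products of increments over the same piece, plus terms with mean zero given the past;
    and independence of the motions gives [Q] the mean square [(t - s)^2 / n]. *)
Section CrossTerms.
Context {R : realType} {dO : measure_display} {Omega : measurableType dO}.
Variable P : probability Omega R.
Variables (T : R) (F : R -> set_system Omega).
Hypothesis F_usual : usual_filtration P T F.
Variables (m : nat) (W : 'I_m -> R -> Omega -> R).
Hypothesis W_bm : forall r, standard_brownian_motion P T F (W r).
Hypothesis W_indep : independent_processes P T W.
Variables (r r' : 'I_m) (s t : R).
Hypotheses (rr' : r != r') (s0 : 0 <= s) (st : s < t) (tT : t <= T).

Section Partition.
Variable n : nat.
Hypothesis n0 : (0 < n)%N.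

Let h := (t - s) / n%:R.
Let tk (k : nat) := s + k%:R * h.
Let D k := increment (W r) (tk k) (tk k.+1).
Let D' k := increment (W r') (tk k) (tk k.+1).
Let Q k w := \sum_(j < k) D j w * D' j w.

Let h0 : 0 < h. Proof. by rewrite divr_gt0 ?subr_gt0// ltr0n. Qed.

Let tkS k : tk k.+1 - tk k = h.
Proof. by rewrite /tk -natr1; ring. Qed.

Let tk_lt k : tk k < tk k.+1. Proof. by rewrite -subr_gt0 tkS. Qed.

Let tk_le j k : (j <= k)%N -> tk j <= tk k.
Proof. by move=> jk; rewrite lerD2l ler_pM2r// ler_nat. Qed.

Let tk_ge0 k : 0 <= tk k. Proof. by rewrite addr_ge0// mulr_ge0// ltW. Qed.

Let tkn : tk n = t.
Proof. by rewrite /tk /h; field; rewrite pnatr_eq0 -lt0n. Qed.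

Let tk_T k : (k <= n)%N -> tk k <= T.
Proof. by move=> kn; apply: le_trans tT; rewrite -tkn tk_le. Qed.

Let tk_in k : (k <= n)%N -> 0 <= tk k <= T.
Proof. by move=> kn; rewrite tk_ge0 tk_T. Qed.

Let F_mono j k : (j <= k)%N -> (k <= n)%N -> F (tk j) `<=` F (tk k).
Proof.
by move=> jk kn; apply: (filtration_mono F_usual) => //; [exact: tk_le|exact: tk_T].
Qed.

Let D_sq k : (k < n)%N -> sq_integrable P (D k) /\ sq_integrable P (D' k).
Proof.
move=> kn; split;
  exact: (increment_sq_integrable F_usual (W_bm _) (tk_ge0 k) (tk_lt k) (tk_T kn)).
Qed.

Let DD'_indep (f g : Omega -> R) :
  measurable_wrt (process_sigma T (W r)) f -> measurable_wrt (process_sigma T (W r')) g ->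
  indep_var P f g.
Proof. exact: independent_processes_pair. Qed.

Let D_wrt k : (k < n)%N -> measurable_wrt (process_sigma T (W r)) (D k) /\
  measurable_wrt (process_sigma T (W r')) (D' k).
Proof.
move=> kn; split; apply: process_sigma_increment; apply: tk_in => //; exact: ltnW.
Qed.

Let separate j k : (j < n)%N -> (k < n)%N ->
  P.-integrable setT (EFin \o (fun w => (D j w * D k w) * (D' j w * D' k w))) /\
  \int[P]_w ((D j w * D k w) * (D' j w * D' k w)) =
  \int[P]_w (D j w * D k w) * \int[P]_w (D' j w * D' k w).
Proof.
move=> jn kn.
have [[Dj D'j] [Dk D'k]] := (D_sq jn, D_sq kn).
have [[wj w'j] [wk w'k]] := (D_wrt jn, D_wrt kn).
have ind : indep_var P (fun w => D j w * D k w) (fun w => D' j w * D' k w).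
  apply: DD'_indep.
  - apply/(measurable_wrt_funP (process_sigma_algebra _ _)); apply: measurable_funM;
      by apply/(measurable_wrt_funP (process_sigma_algebra _ _)).
  - apply/(measurable_wrt_funP (process_sigma_algebra _ _)); apply: measurable_funM;
      by apply/(measurable_wrt_funP (process_sigma_algebra _ _)).
have i1 := sq_integrable_mul Dj Dk; have i2 := sq_integrable_mul D'j D'k.
have m1 := integrable_measurable i1; have m2 := integrable_measurable i2.
split; first exact: indep_integrable_mul.
exact: indep_Rintegral_mul.
Qed.

Let DD'_sq k : (k < n)%N -> sq_integrable P (fun w => D k w * D' k w).
Proof.
move=> kn; have [[mD _] [mD' _]] := D_sq kn; split; first exact: measurable_funM.
have [+ _] := separate kn kn; apply: eq_integrable => // w _ /=.
by congr EFin; ring.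
Qed.

Let Q_sq k : (k <= n)%N -> sq_integrable P (Q k).
Proof.
move=> kn; apply: (sq_integrable_sum (f := fun (j : 'I_k) w => D j w * D' j w)) => j.
by apply: DD'_sq; rewrite (leq_trans _ kn).
Qed.

Let D_orth j k : (j < k)%N -> (k < n)%N -> \int[P]_w (D j w * D k w) = 0.
Proof.
move=> jk kn.
have jn : (j < n)%N := ltn_trans jk kn.
have [[mj ij] _] := D_sq jn.
apply: (past_increment_mean F_usual (W_bm r)) => //; try exact: tk_T.
- apply: measurable_wrt_mono (F_mono jk (ltnW kn)) _.
  by apply: (increment_adapted F_usual (W_bm r)) => //; exact: tk_T.
- by apply: (increment_integrable F_usual (W_bm r)) => //; exact: tk_T.
Qed.

(** The summands of [Q] are orthogonal, each of mean square [h ^+ 2]. *)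
Let Q_mean_sqr k : (k <= n)%N -> \int[P]_w (Q k w ^+ 2) = k%:R * h ^+ 2.
Proof.
elim: k => [_|k IH kn].
  under eq_Rintegral do rewrite /Q big_ord0 expr0n.
  by rewrite mul0r /Rintegral integral0.
have sQ := Q_sq (ltnW kn); have sD := DD'_sq kn.
have iQD := sq_integrable_mul sQ sD.
have -> : \int[P]_w (Q k.+1 w ^+ 2) = \int[P]_w ((Q k w ^+ 2 +
    (D k w * D' k w) ^+ 2) + 2 * (Q k w * (D k w * D' k w))).
  by apply: eq_Rintegral => w _; rewrite /Q big_ord_recr/=; ring.
have iQ2 : P.-integrable setT (EFin \o (fun w => Q k w ^+ 2)) by case: sQ.
have iD2 : P.-integrable setT (EFin \o (fun w => (D k w * D' k w) ^+ 2)) by case: sD.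
rewrite RintegralD//; [|exact: integrable_add|exact: integrable_scale].
rewrite RintegralD// RintegralZl// IH ?(ltnW kn)//.
have -> : \int[P]_w ((D k w * D' k w) ^+ 2) = h ^+ 2.
  have -> : \int[P]_w ((D k w * D' k w) ^+ 2) =
      \int[P]_w ((D k w * D k w) * (D' k w * D' k w)).
    by apply: eq_Rintegral => w _; ring.
  have [_ ->] := separate kn kn.
  have D2 (q : 'I_m) : \int[P]_w (increment (W q) (tk k) (tk k.+1) w *
      increment (W q) (tk k) (tk k.+1) w) = h.
    under eq_Rintegral do rewrite -expr2.
    by rewrite (increment_mean_sqr F_usual (W_bm q)) ?tkS//; exact: tk_T.
  by rewrite !D2 expr2.
have -> : \int[P]_w (Q k w * (D k w * D' k w)) = 0.
  have -> : \int[P]_w (Q k w * (D k w * D' k w)) =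
      \int[P]_w (\sum_(j < k) (D j w * D k w) * (D' j w * D' k w)).
    apply: eq_Rintegral => w _; rewrite /Q mulr_suml.
    by apply: eq_bigr => j _; ring.
  rewrite (Rintegral_sum (f := fun (j : 'I_k) w => (D j w * D k w) * (D' j w * D' k w))).
    apply: big1 => j _.
    have [_ ->] := separate (ltn_trans (ltn_ord j) kn) kn.
    by rewrite D_orth// mul0r.
  by move=> j; have [+ _] := separate (ltn_trans (ltn_ord j) kn) kn.
by rewrite mulr0 addr0 -natr1; ring.
Qed.

Variable c : Omega -> R.
Variable K : R.
Hypotheses (mc : measurable_wrt (F s) c) (cK : forall w, `|c w| <= K).

Let S k := increment (W r) s (tk k).
Let S' k := increment (W r') s (tk k).

Let s_in : 0 <= s <= T. Proof. by rewrite s0 (le_trans (ltW st)). Qed.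

Let mc' : measurable_fun setT c.
Proof. exact: measurable_wrt_measurable (filtration_sub F_usual s_in) mc. Qed.

Let tk0 : tk 0 = s. Proof. by rewrite /tk mul0r addr0. Qed.

Let c_past k : (k <= n)%N -> measurable_wrt (F (tk k)) c.
Proof.
by move=> kn; apply: measurable_wrt_mono mc; rewrite -{1}tk0; exact: F_mono.
Qed.

Let S_sq (q : 'I_m) k : (k <= n)%N ->
  sq_integrable P (increment (W q) s (tk k)) /\
  measurable_wrt (F (tk k)) (increment (W q) s (tk k)).
Proof.
case: k => [_|k kn]; last first.
  have sk : s < tk k.+1 by rewrite -tk0; apply: le_lt_trans (tk_lt k); exact: tk_le.
  split; [apply: (increment_sq_integrable F_usual (W_bm q))
         |apply: (increment_adapted F_usual (W_bm q))] => //; exact: tk_T.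
have -> : increment (W q) s (tk 0) = cst 0.
  by apply/funext => w; rewrite /increment tk0 subrr.
have sF := filtration_sigma F_usual (tk_in (leq0n n)).
split; last by apply/(measurable_wrt_funP sF); exact: measurable_cst.
split; first exact: measurable_cst.
by apply: (eq_integrable measurableT _ _ _ (integrable0 _ _)) => //= w _; rewrite expr0n.
Qed.

Let cS_past (q : 'I_m) k : (k <= n)%N ->
  measurable_wrt (F (tk k)) (fun w => c w * increment (W q) s (tk k) w).
Proof.
move=> kn; have sF := filtration_sigma F_usual (tk_in kn).
apply/(measurable_wrt_funP sF); apply: measurable_funM; apply/(measurable_wrt_funP sF).
- exact: c_past.
- by have [] := S_sq q kn.
Qed.

(** Passing from [k] to [k.+1] adds to the product of the two increments, besides the new
    summand of [Q], two products of a variable known at [tk k] with an increment starting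
    there. *)
Let bracket k : (k <= n)%N ->
  \int[P]_w (c w * (S k w * S' k w)) = \int[P]_w (c w * Q k w).
Proof.
elim: k => [_|k IH kn].
  by apply: eq_Rintegral => w _; rewrite /S /S' /increment /Q tk0 !subrr big_ord0 mul0r.
have kn' := ltnW kn.
have [sS _] := S_sq r kn'; have [sS' _] := S_sq r' kn'.
have [sD sD'] := D_sq kn.
have scS := sq_integrable_bounded_mul mc' cK sS.
have scS' := sq_integrable_bounded_mul mc' cK sS'.
have scD := sq_integrable_bounded_mul mc' cK sD.
have iSS := sq_integrable_mul scS sS'.
have iSD := sq_integrable_mul scS sD'.
have iDS := sq_integrable_mul scS' sD.
have iDD := sq_integrable_mul scD sD'.
have icQ : P.-integrable setT (EFin \o (fun w => c w * Q k w)).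
  by apply: sq_integrable_integrable; exact: sq_integrable_bounded_mul (Q_sq kn').
have stepS (q : 'I_m) w : increment (W q) s (tk k.+1) w =
    increment (W q) s (tk k) w + increment (W q) (tk k) (tk k.+1) w.
  by rewrite /increment; ring.
have -> : \int[P]_w (c w * (S k.+1 w * S' k.+1 w)) =
   \int[P]_w (((c w * S k w) * S' k w + (c w * S k w) * D' k w) +
              ((c w * S' k w) * D k w + (c w * D k w) * D' k w)).
  by apply: eq_Rintegral => w _; rewrite /S /S' !stepS /D /D'; ring.
have -> : \int[P]_w (c w * Q k.+1 w) =
   \int[P]_w (c w * Q k w + (c w * D k w) * D' k w).
  by apply: eq_Rintegral => w _; rewrite /Q big_ord_recr/=; ring.
rewrite !RintegralD//; try exact: integrable_add.
have orth (q q' : 'I_m) : P.-integrable setT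
     (EFin \o (fun w => c w * increment (W q) s (tk k) w)) ->
   \int[P]_w ((c w * increment (W q) s (tk k) w) * increment (W q') (tk k) (tk k.+1) w) = 0.
  move=> i; apply: (past_increment_mean F_usual (W_bm q')) => //; try exact: tk_T.
  exact: cS_past.
have iS (q : 'I_m) : P.-integrable setT (EFin \o (fun w => c w * increment (W q) s (tk k) w)).
  by apply: sq_integrable_integrable; exact: sq_integrable_bounded_mul (S_sq q kn').1.
rewrite (orth r r')// (orth r' r)// addr0 add0r; congr (_ + _).
by rewrite -IH//; apply: eq_Rintegral => w _; rewrite mulrA.
Qed.

(** Expand the mean of [(Q n - l c)^2 >= 0]. *)
Lemma cross_quadratic_bound (l : R) :
  2 * l * \int[P]_w (c w * (increment (W r) s t w * increment (W r') s t w))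
  <= (t - s) ^+ 2 / n%:R + l ^+ 2 * \int[P]_w (c w ^+ 2).
Proof.
have := bracket (leqnn n); rewrite /S /S' tkn => ->.
have sQ := Q_sq (leqnn n).
have sc : sq_integrable P c.
  have := sq_integrable_bounded_mul mc' cK (sq_integrable_cst P 1).
  by under eq_fun do rewrite mulr1.
have iQc := sq_integrable_mul sQ sc.
have -> : (t - s) ^+ 2 / n%:R = \int[P]_w (Q n w ^+ 2).
  by rewrite Q_mean_sqr// /h; field; rewrite pnatr_eq0 -lt0n.
have [_ iQ2] := sQ; have [_ ic2] := sc.
rewrite -subr_ge0.
have -> : \int[P]_w (Q n w ^+ 2) + l ^+ 2 * \int[P]_w (c w ^+ 2)
   - 2 * l * \int[P]_w (c w * Q n w) = \int[P]_w ((Q n w - l * c w) ^+ 2).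
  have -> : \int[P]_w ((Q n w - l * c w) ^+ 2) =
     \int[P]_w ((Q n w ^+ 2 + l ^+ 2 * c w ^+ 2) + (- (2 * l)) * (Q n w * c w)).
    by apply: eq_Rintegral => w _; ring.
  rewrite !RintegralD// ?RintegralZl//; try exact: integrable_scale.
  - rewrite mulNr; congr (_ - _ * _).
    by apply: eq_Rintegral => w _; rewrite mulrC.
  - by apply: integrable_add => //; exact: integrable_scale.
by apply: Rintegral_ge0 => w _; exact: sqr_ge0.
Qed.

End Partition.

Let s_in : 0 <= s <= T. Proof. by rewrite s0 (le_trans (ltW st)). Qed.

Lemma cross_mean_bounded (c : Omega -> R) (K : R) :
  measurable_wrt (F s) c -> (forall w, `|c w| <= K) ->
  \int[P]_w (c w * (increment (W r) s t w * increment (W r') s t w)) = 0.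
Proof.
move=> mc cK.
apply: (@eq0_of_quadratic_bound _ _ ((t - s) ^+ 2) (\int[P]_w (c w ^+ 2))).
- exact: sqr_ge0.
- by apply: Rintegral_ge0 => w _; exact: sqr_ge0.
- by move=> n l n0; exact: cross_quadratic_bound cK l.
Qed.

(** The product [a b] is merely integrable; truncate it at level [n] and pass to the limit
    by dominated convergence. *)
Lemma cross_mean (a b : Omega -> R) :
  measurable_wrt (F s) a -> sq_integrable P a ->
  measurable_wrt (F s) b -> sq_integrable P b ->
  \int[P]_w ((a w * increment (W r) s t w) * (b w * increment (W r') s t w)) = 0.
Proof.
move=> ma sa mb sb.
pose I w := increment (W r) s t w * increment (W r') s t w.
pose c w := a w * b w.
pose c_ (n : nat) w := Num.max (- n%:R) (Num.min n%:R (c w)) : R.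
have sF := filtration_sigma F_usual s_in.
have mc : measurable_wrt (F s) c.
  apply/(measurable_wrt_funP sF).
  by apply: measurable_funM; apply/(measurable_wrt_funP sF).
have mc_ n : measurable_wrt (F s) (c_ n).
  apply/(measurable_wrt_funP sF); apply: measurable_maxr => //.
  by apply: measurable_minr => //; apply/(measurable_wrt_funP sF).
have c_n n w : `|c_ n w| <= n%:R.
  have n0 : 0 <= n%:R :> R by [].
  rewrite /c_ ler_norml le_max lexx/= ge_max ge_min lexx/= andbT.
  by rewrite (le_trans _ n0)// oppr_le0.
have c_c n w : `|c_ n w| <= `|c w| by exact: clamp_norm.
pose Z n w := c_ n w * I w.
pose Z0 w := c w * I w.
have iI : P.-integrable setT (EFin \o Z0).
  have := sq_integrable_mul
    (past_increment_sq_integrable F_usual (W_bm r) s0 st tT ma sa)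
    (past_increment_sq_integrable F_usual (W_bm r') s0 st tT mb sb).
  by apply: eq_integrable => // w _ /=; rewrite /Z0 /c /I; congr EFin; ring.
have mI : measurable_fun setT I.
  by apply: measurable_funM; exact: (measurable_increment F_usual (W_bm _)).
have FM := filtration_sub F_usual s_in.
have mf n : measurable_fun setT (EFin \o Z n).
  apply/measurable_EFinP; apply: measurable_funM => //.
  exact: measurable_wrt_measurable FM (mc_ n).
have mcI : measurable_fun setT (EFin \o Z0).
  by apply/measurable_EFinP; exact: (integrable_measurable iI).
have cvg_cI : {ae P, forall w, setT w ->
    (EFin \o Z n) w @[n --> \oo] --> (EFin \o Z0) w}.
  apply/aeW => w _; apply: cvg_EFin; first by near=> n.
  apply: (@cvgM _ _ _ _ (fun n => c_ n w) (cst (I w))); last exact: cvg_cst.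
  apply: cvg_near_cst; near=> n; apply: clamp_id.
  by near: n; exact: nbhs_infty_ger.
have dom : P.-integrable setT (fun w => `|Z0 w|%:E).
  by have := integrable_norm iI.
have bnd : {ae P, forall w n, setT w ->
    (`|(EFin \o Z n) w| <= `|Z0 w|%:E)%E}.
  by apply/aeW => w n _; rewrite /= lee_fin /Z /Z0 [leLHS]normrM [leRHS]normrM ler_wpM2r.
have [_ _] := dominated_convergence measurableT mf mcI cvg_cI dom bnd.
have int0 n : (\int[P]_w (EFin \o Z n) w = 0)%E.
  have in_ : P.-integrable setT (EFin \o Z n).
    apply: (integrable_dominated _ _ dom) => [|w]; first exact/measurable_EFinP.
    by rewrite /Z /Z0 [leLHS]normrM [leRHS]normrM ler_wpM2r.
  rewrite -[LHS]fineK; last exact: integrable_fin_num.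
  by congr EFin; exact: (@cross_mean_bounded (c_ n) n%:R).
move=> lim_int.
have lim0 : [sequence (\int[P]_w (EFin \o Z n) w)%E]_n @ \oo --> 0%E.
  by under eq_fun do rewrite int0; exact: cvg_cst.
have E0 := cvg_unique (@ereal_hausdorff R) lim_int lim0.
rewrite /Rintegral -[RHS]/(fine 0%E) -[in RHS]E0; congr fine.
by apply: eq_integral => w _ /=; rewrite /Z0 /c /I; congr EFin; ring.
Unshelve. all: by end_near. Qed.
End CrossTerms.

(** * Square-integrable random vectors and conditional expectations *)

Section L2.
Context {R : realType} {dO : measure_display} {Omega : measurableType dO}.
Variable P : probability Omega R.

Lemma poweR2 (x : \bar R) : (0 <= x)%E -> (x `^ 2 = x ^+ 2)%E.
Proof.
case: x => [r| |]//= r0.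
- by rewrite powR_mulrn// EFin_expe.
- by rewrite pnatr_eq0 /= mulyy.
Qed.

Lemma L2norm_sqr d (Y : Omega -> 'rV[R]_d) :
  (L2norm P Y ^+ 2 = \int[P]_w (dotp (Y w) (Y w))%:E)%E.
Proof.
rewrite -poweR2 ?Lnorm_ge0// poweR_Lnorm//.
apply: eq_integral => w _ /=.
by rewrite ger0_norm ?enorm_ge0// powR_mulrn ?enorm_ge0// enorm_sqr.
Qed.

Lemma L2norm_lty d (Y : Omega -> 'rV[R]_d) :
  (L2norm P Y < +oo <-> \int[P]_w (dotp (Y w) (Y w))%:E < +oo)%E.
Proof.
rewrite -L2norm_sqr -poweR2 ?Lnorm_ge0//; split; first exact: poweR_lty.
by apply: lty_poweRy.
Qed.

Lemma dotp_integrable d (Y Z : Omega -> 'rV[R]_d) :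
  (forall i, sq_integrable P (fun w => Y w 0 i)) ->
  (forall i, sq_integrable P (fun w => Z w 0 i)) ->
  P.-integrable setT (EFin \o (fun w => dotp (Y w) (Z w))).
Proof.
move=> sY sZ; apply: (integrable_sum_fun (f := fun i w => Y w 0 i * Z w 0 i)) => i.
exact: sq_integrable_mul.
Qed.

Lemma L2norm_sqr_fin d (Y : Omega -> 'rV[R]_d) :
  (forall i, sq_integrable P (fun w => Y w 0 i)) ->
  (L2norm P Y ^+ 2 = (\int[P]_w dotp (Y w) (Y w))%:E)%E.
Proof.
move=> sY; rewrite L2norm_sqr fineK//; apply: integrable_fin_num => //.
exact: dotp_integrable.
Qed.

Section SubSigma.
Variable G : set_system Omega.
Hypotheses (sG : sigma_algebra setT G) (GM : G `<=` measurable).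

Lemma inL2P d (Y : Omega -> 'rV[R]_d) : inL2 P G Y <->
  forall i, measurable_wrt G (fun w => Y w 0 i) /\ sq_integrable P (fun w => Y w 0 i).
Proof.
split=> [[mY nY] i|H]; last first.
  split; first by apply/(measurable_wrt_rVP sG) => i; have [] := H i.
  apply/L2norm_lty; apply: integrable_lty => //.
  by apply: dotp_integrable => i; have [] := H i.
have mYi j : measurable_wrt G (fun w => Y w 0 j) by move: j; exact/(measurable_wrt_rVP sG).
split => //; have mi j := measurable_wrt_measurable GM (mYi j).
split=> //.
have mdot : measurable_fun setT (fun w => dotp (Y w) (Y w)).
  by apply: measurable_sum => j; exact: measurable_funM.
apply: (integrable_dominated (g := fun w => dotp (Y w) (Y w))).
- exact: measurable_funX.
- by move=> w; rewrite ger0_norm ?sqr_ge0// sqr_coord_le_dotp.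
- apply/integrableP; split; first exact/measurable_EFinP.
  under eq_integral do rewrite /= ger0_norm ?dotp_ge0//.
  exact/L2norm_lty.
Qed.

(** A Lipschitz map is continuous, hence measurable, and has linear growth. *)
Lemma inL2_lipschitz d d' (h : 'rV[R]_d -> 'rV[R]_d') (K : R) (Y : Omega -> 'rV[R]_d) :
  (forall x y, dotp (h x - h y) (h x - h y) <= K * dotp (x - y) (x - y)) ->
  inL2 P G Y -> inL2 P G (h \o Y).
Proof.
move=> hK YL2; have [mY _] := YL2; have /inL2P YL2i := YL2.
have ch : continuous h.
  by apply: locally_lipschitz_continuous => x; exists K => y _; exact: hK.
have mhY := measurable_wrt_comp sG ch mY.
apply/inL2P => i.
have mi : measurable_wrt G (fun w => (h \o Y) w 0 i).
  by move: i; exact/(measurable_wrt_rVP sG).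
split => //; split; first exact: measurable_wrt_measurable GM mi.
have iY : P.-integrable setT (EFin \o (fun w => dotp (Y w) (Y w))).
  by apply: dotp_integrable => j; have [] := YL2i j.
have i1 : P.-integrable setT (EFin \o (cst (2 * dotp (h 0) (h 0)) : Omega -> R)).
  exact: finite_measure_integrable_cst.
apply: (integrable_dominated _ _ (integrable_add (integrable_scale (2 * K) iY) i1)).
  by apply: measurable_funX; exact: measurable_wrt_measurable GM mi.
move=> w; rewrite ger0_norm ?sqr_ge0//=; apply: le_trans (sqr_coord_le_dotp _ i) _.
have := hK (Y w) 0; rewrite subr0 => lip.
have := dotp_double (h (Y w)) (h 0).
by move: lip; move: (dotp (h (Y w)) _) (dotp (h (Y w) - h 0) _) => a b lip; lra.
Qed.

(** The event that one version exceeds the other belongs to [G], and the difference has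
    zero integral over it. *)
Lemma is_condexp_unique (X V1 V2 : Omega -> R) :
  is_condexp P G X V1 -> is_condexp P G X V2 -> {ae P, forall w, V1 w = V2 w}.
Proof.
move=> c1 c2.
suff half (U1 U2 : Omega -> R) : is_condexp P G X U1 -> is_condexp P G X U2 ->
    {ae P, forall w, U1 w <= U2 w}.
  have h1 := half _ _ c1 c2; have h2 := half _ _ c2 c1.
  by apply: filterS2 h1 h2 => w u1 u2; apply/eqP; rewrite eq_le u1 u2.
move=> [m1 i1 e1] [m2 i2 e2].
pose A := [set w | U2 w < U1 w].
have GA : G A.
  have -> : A = (fun w => U1 w - U2 w) @^-1` [set x | 0 < x].
    by apply/seteqP; split => w; rewrite /A /= subr_gt0.
  have mD : measurable_wrt G (fun w => U1 w - U2 w).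
    apply/(measurable_wrt_funP sG).
    by apply: measurable_funB; apply/(measurable_wrt_funP sG).
  apply: mD; rewrite borel_measurable -set_itvoy; exact: measurable_itv.
have mA := GM GA.
have iS (U : Omega -> R) : P.-integrable setT (EFin \o U) -> P.-integrable A (EFin \o U).
  by apply: integrableS.
have mU (U : Omega -> R) : P.-integrable setT (EFin \o U) -> measurable_fun setT U.
  exact: integrable_measurable.
have i0 : (\int[P]_(w in A) `|(U1 w - U2 w)%:E| = 0)%E.
  have -> : (\int[P]_(w in A) `|(U1 w - U2 w)%:E| =
             \int[P]_(w in A) ((U1 w)%:E - (U2 w)%:E))%E.
    apply: eq_integral => w; rewrite inE /A /= => lt12.
    by rewrite ger0_norm ?EFinB// subr_ge0 ltW.
  rewrite integralB_EFin//; [|exact: iS..].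
  rewrite e1// e2// subee//.
  by rewrite -e1//; apply: integrable_fin_num => //; exact: iS.
have mD : measurable_fun A (fun w => (U1 w - U2 w)%:E).
  apply/measurable_EFinP; apply: measurable_funTS.
  by apply: measurable_funB; exact: mU.
have := (ae_eq_integral_abs P mA mD).1 i0.
apply: filterS => w /= Aw; rewrite leNgt; apply/negP => lt12.
by have /eqP := Aw lt12; rewrite eqe subr_eq0 => /eqP E12; rewrite E12 ltxx in lt12.
Qed.

(** Exhibiting one conditional expectation is what shows that the chosen version is one. *)
Lemma condexp_ae (X V : Omega -> R) : is_condexp P G X V ->
  is_condexp P G X (condexp P G X) /\ {ae P, forall w, condexp P G X w = V w}.
Proof.
move=> cV; have cX : is_condexp P G X (condexp P G X).
  exact: (@xgetPex _ (fun=> 0) [set U | is_condexp P G X U] (ex_intro _ V cV)).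
by split => //; exact: is_condexp_unique cX cV.
Qed.

End SubSigma.

Lemma L2norm_sqr_ae d (Y Z : Omega -> 'rV[R]_d) :
  (forall i, measurable_fun setT (fun w => Y w 0 i)) ->
  (forall i, measurable_fun setT (fun w => Z w 0 i)) ->
  (forall i, {ae P, forall w, Y w 0 i = Z w 0 i}) ->
  (L2norm P Y ^+ 2 = L2norm P Z ^+ 2)%E.
Proof.
move=> mY mZ YZ; rewrite !L2norm_sqr; apply: ae_eq_integral => //.
- by apply/measurable_EFinP; apply: measurable_sum => j; exact: measurable_funM.
- by apply/measurable_EFinP; apply: measurable_sum => j; exact: measurable_funM.
- have : {ae P, forall w i, Y w 0 i = Z w 0 i} by exact: filter_forall.
  apply: filterS => w yz _.
  by congr EFin; apply: eq_bigr => i _; rewrite yz.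
Qed.

End L2.

(** * Sums of Brownian increments with frozen coefficients *)

Section ItoSum.
Context {R : realType} {dO : measure_display} {Omega : measurableType dO}.
Variable P : probability Omega R.
Variables (T : R) (F : R -> set_system Omega).
Hypothesis F_usual : usual_filtration P T F.
Variables (m : nat) (W : 'I_m -> R -> Omega -> R).
Hypothesis W_bm : forall r, standard_brownian_motion P T F (W r).
Hypothesis W_indep : independent_processes P T W.
Variables (s t : R).
Hypotheses (s0 : 0 <= s) (st : s < t) (tT : t <= T).
Variable a : 'I_m -> Omega -> R.
Hypothesis a_past : forall r, measurable_wrt (F s) (a r).
Hypothesis a_sq : forall r, sq_integrable P (a r).

(** The stochastic integral over [[s, t]] of integrands frozen at time [s]. *)
Definition ito_sum w := \sum_(r < m) a r w * increment (W r) s t w.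

Let s_in : 0 <= s <= T. Proof. by rewrite s0 (le_trans (ltW st)). Qed.
Let t_in : 0 <= t <= T. Proof. by rewrite tT andbT (le_trans s0 (ltW st)). Qed.

Let term_sq r : sq_integrable P (fun w => a r w * increment (W r) s t w).
Proof. exact: (past_increment_sq_integrable F_usual (W_bm r)). Qed.

Lemma ito_sum_sq_integrable : sq_integrable P ito_sum.
Proof. exact: sq_integrable_sum. Qed.

Lemma ito_sum_adapted : measurable_wrt (F t) ito_sum.
Proof.
have sF := filtration_sigma F_usual t_in.
apply/(measurable_wrt_funP sF); apply: measurable_sum => r.
apply: measurable_funM; apply/(measurable_wrt_funP sF).
- by apply: measurable_wrt_mono (a_past r); apply: (filtration_mono F_usual) => //; exact: ltW.
- exact: (increment_adapted F_usual (W_bm r)).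
Qed.

(** Restricting to an event of [F s] amounts to multiplying the coefficients by its
    indicator, which keeps them known at time [s]. *)
Lemma ito_sum_martingale (A : set Omega) : F s A ->
  (\int[P]_(w in A) (ito_sum w)%:E = 0)%E.
Proof.
move=> FA; have mA := filtration_sub F_usual s_in FA.
have sF := filtration_sigma F_usual s_in.
have mI : measurable_wrt (F s) (\1_A : Omega -> R).
  apply/(measurable_wrt_funP sF); apply: measurable_indic.
  by rewrite (measurable_sigmaE sF).
have I1 w : `|\1_A w : R| <= 1 by rewrite indicE; case: (_ \in _); rewrite ?normr1 ?normr0.
pose b r w := \1_A w * a r w : R.
have mb r : measurable_wrt (F s) (b r).
  by apply/(measurable_wrt_funP sF); apply: measurable_funM; apply/(measurable_wrt_funP sF).
have sb r : sq_integrable P (b r).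
  apply: (sq_integrable_bounded_mul _ I1) => //; exact: measurable_indic.
have ib r : P.-integrable setT (EFin \o b r).
  exact: sq_integrable_integrable.
have E0 : \int[P]_w (\sum_(r < m) b r w * increment (W r) s t w) = 0.
  rewrite (Rintegral_sum (f := fun r w => b r w * increment (W r) s t w)).
    by apply: big1 => r _; exact: (past_increment_mean F_usual (W_bm r)).
  by move=> r; exact: (past_increment_integrable F_usual (W_bm r)).
rewrite integral_mkcond -[RHS]/((0 : R)%:E) -E0 fineK.
  apply: eq_integral => w _; rewrite patchE /b.
  under eq_bigr do rewrite -mulrA; rewrite -mulr_sumr indicE.
  by case: (w \in A); rewrite ?mul1r ?mul0r.
apply: integrable_fin_num => //.
apply: (integrable_sum_fun (f := fun r w => b r w * increment (W r) s t w)) => r.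
exact: (past_increment_integrable F_usual (W_bm r)).
Qed.

(** The cross terms vanish by orthogonality of distinct Brownian motions. *)
Lemma ito_isometry :
  \int[P]_w (ito_sum w ^+ 2) = (t - s) * \sum_(r < m) \int[P]_w (a r w ^+ 2).
Proof.
pose e r w := a r w * increment (W r) s t w.
have ie r r' : P.-integrable setT (EFin \o (fun w => e r w * e r' w)).
  exact: sq_integrable_mul (term_sq r) (term_sq r').
have -> : \int[P]_w (ito_sum w ^+ 2) =
    \int[P]_w (\sum_(r < m) \sum_(r' < m) e r w * e r' w).
  apply: eq_Rintegral => w _; rewrite expr2 /ito_sum mulr_suml.
  by apply: eq_bigr => r _; rewrite mulr_sumr.
rewrite (Rintegral_sum (f := fun r w => \sum_(r' < m) e r w * e r' w)); last first.
  by move=> r; exact: (integrable_sum_fun (f := fun r' w => e r w * e r' w)).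
rewrite mulr_sumr; apply: eq_bigr => r _.
rewrite (Rintegral_sum (f := fun r' w => e r w * e r' w))// (bigD1 r)//= big1 ?addr0.
  under eq_Rintegral do rewrite -expr2.
  exact: (past_increment_mean_sqr F_usual (W_bm r)).
move=> r' r'r; have rr' : r != r' by rewrite eq_sym.
exact: (cross_mean F_usual W_bm W_indep rr').
Qed.

End ItoSum.

(** * Stochastic C-stability *)

Section SSBEStability.
Context {R : realType} {dO : measure_display} {Omega : measurableType dO} {d m : nat}.
Variable P : probability Omega R.
Variables (T : R) (F : R -> set_system Omega).
Hypothesis F_usual : usual_filtration P T F.
Variable W : 'I_m -> R -> Omega -> R.
Hypothesis W_bm : forall r, standard_brownian_motion P T F (W r).
Hypothesis W_indep : independent_processes P T W.
Variables (f : R -> 'rV[R]_d -> 'rV[R]_d) (g : 'I_m -> R -> 'rV[R]_d -> 'rV[R]_d).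
Variables (L eta q hbar : R).
Hypothesis m_gt0 : (0 < m)%N.
Hypothesis fg_adm : admissible T L eta q f g.
Hypothesis hbar_ltL : hbar < L^-1.
Variables (t delta : R).
Hypotheses (t_ge0 : 0 <= t) (delta_gt0 : 0 < delta) (delta_le : delta <= hbar)
  (tdT : t + delta <= T).

Let td_in : 0 <= t + delta <= T. Proof. by rewrite addr_ge0 ?(ltW delta_gt0). Qed.
Let ttd : t < t + delta. Proof. by rewrite ltrDl. Qed.
Let t_in : 0 <= t <= T. Proof. by rewrite t_ge0 (le_trans (ltW ttd)). Qed.
Let sFt := filtration_sigma F_usual t_in.
Let FtM := filtration_sub F_usual t_in.

Let drift (Y : Omega -> 'rV[R]_d) w := implicit_inv f delta (t + delta) (Y w).
Let diff r (Y : Omega -> 'rV[R]_d) w := g r (t + delta) (drift Y w).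

Let drift_inL2 Y : inL2 P (F t) Y -> inL2 P (F t) (drift Y).
Proof.
apply: (inL2_lipschitz sFt FtM (K := ((1 - delta * L) ^+ 2)^-1)) => x y.
rewrite mulrC.
exact: (implicit_inv_lipschitz m_gt0 fg_adm hbar_ltL td_in delta_gt0 delta_le).
Qed.

Let diff_inL2 r Y : inL2 P (F t) Y -> inL2 P (F t) (diff r Y).
Proof.
exact: (inL2_lipschitz sFt FtM
  (h := fun x => g r (t + delta) (implicit_inv f delta (t + delta) x))
  (fun x y => diffusion_implicit_inv_lipschitz m_gt0 fg_adm hbar_ltL td_in
    delta_gt0 delta_le x y r)).
Qed.

Lemma ssbe_step_coord Y i w : apply_step (ssbe_step f g W) Y t delta w 0 i =
  drift Y w 0 i + \sum_(r < m) diff r Y w 0 i * increment (W r) t (t + delta) w.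
Proof.
rewrite /apply_step /ssbe_step mxE summxE; congr (_ + _).
by apply: eq_bigr => r _; rewrite mxE mulrC.
Qed.

Lemma ssbe_step_inL2 Y : inL2 P (F t) Y ->
  inL2 P (F (t + delta)) (apply_step (ssbe_step f g W) Y t delta).
Proof.
move=> YL2.
have sF := filtration_sigma F_usual td_in.
apply/(inL2P P sF (filtration_sub F_usual td_in)) => i.
have /(inL2P P sFt FtM) /(_ i) [my sy] := drift_inL2 YL2.
have mg r : measurable_wrt (F t) (fun w => diff r Y w 0 i).
  by have /(inL2P P sFt FtM) /(_ i) [] := diff_inL2 r YL2.
have sg r : sq_integrable P (fun w => diff r Y w 0 i).
  by have /(inL2P P sFt FtM) /(_ i) [] := diff_inL2 r YL2.
have -> : (fun w => apply_step (ssbe_step f g W) Y t delta w 0 i) =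
    (fun w => drift Y w 0 i + ito_sum W t (t + delta) (fun r w => diff r Y w 0 i) w).
  by apply/funext => w; exact: ssbe_step_coord.
split.
- apply/(measurable_wrt_funP sF); apply: measurable_funD; apply/(measurable_wrt_funP sF).
  + by apply: measurable_wrt_mono my; apply: (filtration_mono F_usual) => //; exact: ltW.
  + exact: (ito_sum_adapted F_usual W_bm).
- by apply: sq_integrable_add => //; exact: (ito_sum_sq_integrable F_usual W_bm).
Qed.

Section TwoStates.
Variables Y Z : Omega -> 'rV[R]_d.
Hypotheses (YL2 : inL2 P (F t) Y) (ZL2 : inL2 P (F t) Z).

Let D w := apply_step (ssbe_step f g W) Y t delta w - apply_step (ssbe_step f g W) Z t delta w.
Let Dy w := drift Y w - drift Z w.
Let Dg r w := diff r Y w - diff r Z w.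
Let N w : 'rV[R]_d := \row_i ito_sum W t (t + delta) (fun r w => Dg r w 0 i) w.

Let sub_L2 (U V : Omega -> 'rV[R]_d) i : inL2 P (F t) U -> inL2 P (F t) V ->
  measurable_wrt (F t) (fun w => (U w - V w) 0 i) /\
  sq_integrable P (fun w => (U w - V w) 0 i).
Proof.
move=> /(inL2P P sFt FtM) /(_ i) [mU sU] /(inL2P P sFt FtM) /(_ i) [mV sV].
have -> : (fun w => (U w - V w) 0 i) = (fun w => U w 0 i - V w 0 i).
  by apply/funext => w; rewrite !mxE.
split; last exact: sq_integrable_sub.
by apply/(measurable_wrt_funP sFt); apply: measurable_funB; apply/(measurable_wrt_funP sFt).
Qed.

Let mDy i : measurable_wrt (F t) (fun w => Dy w 0 i).
Proof. by have [] := sub_L2 i (drift_inL2 YL2) (drift_inL2 ZL2). Qed.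
Let sDy i : sq_integrable P (fun w => Dy w 0 i).
Proof. by have [] := sub_L2 i (drift_inL2 YL2) (drift_inL2 ZL2). Qed.
Let mDg r i : measurable_wrt (F t) (fun w => Dg r w 0 i).
Proof. by have [] := sub_L2 i (diff_inL2 r YL2) (diff_inL2 r ZL2). Qed.
Let sDg r i : sq_integrable P (fun w => Dg r w 0 i).
Proof. by have [] := sub_L2 i (diff_inL2 r YL2) (diff_inL2 r ZL2). Qed.

Let sN i : sq_integrable P (fun w => N w 0 i).
Proof.
have -> : (fun w => N w 0 i) = ito_sum W t (t + delta) (fun r w => Dg r w 0 i).
  by apply/funext => w; rewrite mxE.
exact: (ito_sum_sq_integrable F_usual W_bm).
Qed.

Let DE i w : D w 0 i = Dy w 0 i + N w 0 i.
Proof.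
have subE (u v : 'rV[R]_d) : (u - v) 0 i = u 0 i - v 0 i by rewrite !mxE.
rewrite /D /Dy !subE !ssbe_step_coord /N mxE /ito_sum opprD addrACA.
congr (_ + _); rewrite -sumrB; apply: eq_bigr => r _.
by rewrite /Dg subE mulrBl.
Qed.

(** The noise has vanishing conditional mean, so [Dy] is a version of the conditional
    expectation of [D]. *)
Let condexp_D i : is_condexp P (F t) (fun w => D w 0 i) (fun w => Dy w 0 i).
Proof.
have iDy : P.-integrable setT (EFin \o (fun w => Dy w 0 i)).
  exact: sq_integrable_integrable.
have iN : P.-integrable setT (EFin \o (fun w => N w 0 i)).
  exact: sq_integrable_integrable.
split => // A FA; have mA := FtM FA.
have -> : (\int[P]_(w in A) (D w 0 i)%:E =
   \int[P]_(w in A) ((Dy w 0 i)%:E + (N w 0 i)%:E))%E.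
  by apply: eq_integral => w _; rewrite DE EFinD.
rewrite integralD//; [|exact: (integrableS measurableT)..].
have -> : (\int[P]_(w in A) (N w 0 i)%:E = 0)%E.
  under eq_integral do rewrite mxE.
  exact: (ito_sum_martingale F_usual W_bm).
by rewrite adde0.
Qed.

Let ED := condexpv P (F t) D.

Let EDE i w : ED w 0 i = condexp P (F t) (fun w => D w 0 i) w.
Proof. by rewrite mxE. Qed.

Let ED_ae i : {ae P, forall w, ED w 0 i = Dy w 0 i}.
Proof.
have [_] := condexp_ae sFt FtM (condexp_D i).
by apply: filterS => w <-; rewrite EDE.
Qed.

Let mED i : measurable_fun setT (fun w => ED w 0 i).
Proof.
have [[mE _ _] _] := condexp_ae sFt FtM (condexp_D i).
have -> : (fun w => ED w 0 i) = condexp P (F t) (fun w => D w 0 i).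
  by apply/funext => w; rewrite EDE.
exact: measurable_wrt_measurable FtM mE.
Qed.

Let mean_sqr_noise : \int[P]_w dotp (N w) (N w) =
  delta * \int[P]_w (\sum_(r < m) dotp (Dg r w) (Dg r w)).
Proof.
have iN i : P.-integrable setT (EFin \o (fun w => N w 0 i ^+ 2)) by case: (sN i).
have iDg r i : P.-integrable setT (EFin \o (fun w => Dg r w 0 i ^+ 2)) by case: (sDg r i).
have -> : \int[P]_w dotp (N w) (N w) = \int[P]_w (\sum_(i < d) N w 0 i ^+ 2).
  by apply: eq_Rintegral => w _; apply: eq_bigr => i _; rewrite expr2.
rewrite (Rintegral_sum (f := fun i w => N w 0 i ^+ 2))//.
have -> : \sum_(i < d) \int[P]_w (N w 0 i ^+ 2) =
    \sum_(i < d) delta * \sum_(r < m) \int[P]_w (Dg r w 0 i ^+ 2).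
  apply: eq_bigr => i _; under eq_Rintegral do rewrite mxE.
  rewrite (ito_isometry F_usual W_bm W_indep)//.
  by rewrite addrAC subrr add0r.
rewrite -mulr_sumr exchange_big/=; congr (_ * _).
rewrite (Rintegral_sum (f := fun r w => dotp (Dg r w) (Dg r w))); last first.
  by move=> r; exact: dotp_integrable.
apply: eq_bigr => r _.
rewrite -(Rintegral_sum (f := fun i w => Dg r w 0 i ^+ 2))//.
Qed.

(** Conditioning splits the difference of the two steps into the drift difference and the
    noise; by the isometry the claim is the expectation of the pathwise bound. *)
Lemma ssbe_step_stable :
  (L2norm P ED ^+ 2 + (2 * eta)%:E * L2norm P (fun w => D w - ED w)%R ^+ 2
   <= (1 + 2 * L / (1 - hbar * L) ^+ 2 * delta)%:E
      * L2norm P (fun w => Y w - Z w)%R ^+ 2)%E.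
Proof.
have sYZ i : sq_integrable P (fun w => (Y w - Z w) 0 i) by have [] := sub_L2 i YL2 ZL2.
have mDy' i := measurable_wrt_measurable FtM (mDy i).
have -> : (L2norm P ED ^+ 2 = L2norm P Dy ^+ 2)%E by exact: L2norm_sqr_ae.
have subE (u v : 'rV[R]_d) i : (u - v) 0 i = u 0 i - v 0 i by rewrite !mxE.
have -> : (L2norm P (fun w => D w - ED w)%R ^+ 2 = L2norm P N ^+ 2)%E.
  apply: L2norm_sqr_ae => i.
  - have -> : (fun w => (D w - ED w) 0 i) = (fun w => (Dy w 0 i + N w 0 i) - ED w 0 i).
      by apply/funext => w; rewrite subE DE.
    apply: measurable_funB => //; apply: measurable_funD => //.
    by case: (sN i).
  - by case: (sN i).
  - by apply: filterS (ED_ae i) => w EDw; rewrite subE DE EDw addrAC subrr add0r.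
rewrite !L2norm_sqr_fin// -!EFinM -EFinD lee_fin mean_sqr_noise.
have iS : P.-integrable setT (EFin \o (fun w => \sum_(r < m) dotp (Dg r w) (Dg r w))).
  apply: (integrable_sum_fun (f := fun r w => dotp (Dg r w) (Dg r w))) => r.
  exact: dotp_integrable.
have iDy := dotp_integrable sDy sDy; have iYZ := dotp_integrable sYZ sYZ.
pose S w := \sum_(r < m) dotp (Dg r w) (Dg r w).
have -> : 2 * eta * (delta * \int[P]_w S w) = \int[P]_w (2 * eta * delta * S w).
  by rewrite RintegralZl// mulrA.
rewrite -RintegralZl// -RintegralD//; last exact: integrable_scale.
apply: le_Rintegral => //.
- by apply: integrable_add => //; exact: integrable_scale.
- exact: integrable_scale.
- move=> w _; rewrite -mulrA.
  exact: (ssbe_pathwise_stability m_gt0 fg_adm hbar_ltL td_in delta_gt0 delta_le).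
Qed.

End TwoStates.
End SSBEStability.

Theorem theorem5p2 (R : realType) (d m : nat) (d_gt0 : (0 < d)%N)
    (m_gt0 : (0 < m)%N) (T : R) (T_gt0 : 0 < T)
    (dO : measure_display) (Omega : measurableType dO)
    (P : probability Omega R) (F : R -> set_system Omega)
    (F_usual : usual_filtration P T F)
    (W : 'I_m -> R -> Omega -> R)
    (W_bm : forall r, standard_brownian_motion P T F (W r))
    (W_indep : independent_processes P T W)
    (f : R -> 'rV[R]_d -> 'rV[R]_d)
    (g : 'I_m -> R -> 'rV[R]_d -> 'rV[R]_d)
    (L eta q hbar : R)
    (fg_adm : admissible T L eta q f g) (eta_gt1 : 1 < eta)
    (hbar_gt0 : 0 < hbar) (hbar_ltL : hbar < L^-1) (hbar_leT : hbar <= T) :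
  forall xi : Omega -> 'rV[R]_d, inL2 P (F 0) xi ->
    stochastically_C_stable P T F (ssbe_step f g W) hbar xi.
Proof.
move=> xi xi_L2; split.
  split=> // t delta [/= /andP[t0 _] /andP[delta0 delta_le] tdT] Z ZL2.
  exact: (ssbe_step_inL2 F_usual W_bm m_gt0 fg_adm hbar_ltL t0 delta0 delta_le tdT ZL2).
exists (2 * L / (1 - hbar * L) ^+ 2), (2 * eta); split; first by lra.
move=> t delta [/= /andP[t0 _] /andP[delta0 delta_le] tdT] Y Z YL2 ZL2.
exact: (ssbe_step_stable F_usual W_bm W_indep m_gt0 fg_adm hbar_ltL t0 delta0
  delta_le tdT YL2 ZL2).
Qed.
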